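(* Let $\lambda_1,\lambda_2>0$, $\alpha_1,\alpha_2\in(0,1)$, $\mu_1,\mu_2>0$, and let $S^{\mu_1,\mu_2}_{\alpha_1,\alpha_2}(t)=N_1(D_{\alpha_1,\mu_1}(t))-N_2(D_{\alpha_2,\mu_2}(t))$ be the tempered space-fractional Skellam process. Its probability mass function $H_k^{\mu_1,\mu_2}(t)=\mathbb{P}(S^{\mu_1,\mu_2}_{\alpha_1,\alpha_2}(t)=k)$ is given, for integers $k\ge0$, by $$\begin{aligned}H_k^{\mu_1,\mu_2}(t)=\sum_{n=0}^\infty\frac{(-1)^k}{n!(n+k)!}e^{t(\mu_1^{\alpha_1}+\mu_2^{\alpha_2})}&\left(\sum_{m=0}^\infty\frac{\mu_1^m\lambda_1^{-m}}{m!}\,{}_1\psi_1\left[\begin{matrix}(1,\alpha_1);\\(1-n-k-m,\alpha_1);\end{matrix}(-\lambda_1^{\alpha_1}t)\right]\right)\\&\times\left(\sum_{l=0}^\infty\frac{\mu_2^l\lambda_2^{-l}}{l!}\,{}_1\psi_1\left[\begin{matrix}(1,\alpha_2);\\(1-l-n,\alpha_2);\end{matrix}(-\lambda_2^{\alpha_2}t)\right]\right),\end{aligned}$$ and, for integers $k<0$, by $$\begin{aligned}H_k^{\mu_1,\mu_2}(t)=\sum_{n=0}^\infty\frac{(-1)^{|k|}}{n!(n+|k|)!}e^{t(\mu_1^{\alpha_1}+\mu_2^{\alpha_2})}&\left(\sum_{m=0}^\infty\frac{\mu_1^m\lambda_1^{-m}}{m!}\,{}_1\psi_1\left[\begin{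matrix}(1,\alpha_1);\\(1-n-m,\alpha_1);\end{matrix}(-\lambda_1^{\alpha_1}t)\right]\right)\\&\times\left(\sum_{l=0}^\infty\frac{\mu_2^l\lambda_2^{-l}}{l!}\,{}_1\psi_1\left[\begin{matrix}(1,\alpha_2);\\(1-l-n-|k|,\alpha_2);\end{matrix}(-\lambda_2^{\alpha_2}t)\right]\right).\end{aligned}$$
   Context: $N_1,N_2$ are independent homogeneous Poisson processes with intensities $\lambda_1,\lambda_2$; $D_{\alpha_1,\mu_1},D_{\alpha_2,\mu_2}$ are independent tempered stable subordinators, $\mathbb{E}[e^{-sD_{\alpha_i,\mu_i}(t)}]=e^{-t((s+\mu_i)^{\alpha_i}-\mu_i^{\alpha_i})}$, independent of $N_1,N_2$. The Fox–Wright function is $${}_1\psi_1\left[\begin{matrix}(a,\alpha);\\(b,\beta);\end{matrix}(z)\right]=\sum_{r=0}^\infty\frac{\Gamma(a+\alpha r)}{\Gamma(b+\beta r)}\frac{z^r}{r!},$$ with $1/\Gamma$ taken to be $0$ at the poles of $\Gamma$.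
   Formalization: The formula is asserted whenever the inner series over m and l converge, which is proved if μ_i<λ_i; for μ_i≥λ_i and t>0 these series diverge, so the formula as printed for all μ_i>0 has no meaning there. *)

(* Defs.v *)
From HB Require Import structures.
From mathcomp Require Import all_boot all_order all_algebra.
From mathcomp Require Import all_classical all_reals all_analysis.

Set Implicit Arguments.
Unset Strict Implicit.
Unset Printing Implicit Defensive.

Import Order.TTheory GRing.Theory Num.Theory.
Import numFieldNormedType.Exports.

Local Open Scope classical_set_scope.
Local Open Scope ring_scope.

Section special_functions.
Context {R : realType}.
Implicit Types (x z alpha lambda mu t : R).

Definition euler_gamma x : R :=
  \int[lebesgue_measure]_(u in `]0, +oo[) (u `^ (x - 1) * expR (- u)).

(* Gamma on the whole real line: Euler's integral for 0 < x, and
   Gamma x = Gamma (x + n) / (x (x + 1) ... (x + n - 1)) for x <= 0, with n the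
   least natural number such that 0 < x + n.  At the poles x = 0, -1, -2, ...
   the product vanishes, so that Gamma x = 0 by the convention 0^-1 = 0, and
   hence (Gamma x)^-1 = 0 there, the usual value of 1 / Gamma. *)
Definition Gamma x : R :=
  if 0 < x then euler_gamma x
  else let n := (Num.truncn (- x)).+1 in
       euler_gamma (x + n%:R) / \prod_(0 <= i < n) (x + i%:R).

(* 1psi1 [ (a, alpha); (b, beta); z ] *)
Definition fox_wright (a alpha b beta z : R) : R :=
  limn (series (fun r : nat =>
    Gamma (a + alpha * r%:R) / Gamma (b + beta * r%:R) * (z ^+ r / r`!%:R))).

(* With f x = exp (- t x^alpha), the Fox-Wright value below equals
   lambda^(j + m) f^(j + m)(lambda), so that, up to the factor lambda^j, the
   series of general term  tsf_term ... j m  (m = 0, 1, ...)  is the Taylor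
   series of f^(j) about lambda evaluated at lambda + mu.  If 0 < t, the
   branch point of f at 0 makes the radius of convergence equal to lambda: the
   series converges for mu < lambda and diverges for mu > lambda. *)
Definition tsf_term alpha lambda mu t (j m : nat) : R :=
  mu ^+ m * lambda ^- m / m`!%:R *
  fox_wright 1 alpha (1 - j%:R - m%:R) alpha (- (lambda `^ alpha) * t).

End special_functions.

Section processes.
Context d (T : measurableType d) (R : realType) (P : probability T R).

(* The F i are families of events; independence is the product rule over every
   subfamily. *)
Definition mutually_independent (I : finType) (F : I -> set (set T)) : Prop :=
  forall (J : {set I}) (A : I -> set T),
    (forall i, i \in J -> F i (A i)) ->
    P (\bigcap_(i in [set` J]) A i) = (\prod_(i in J) P (A i))%E.

Definition sigma_var (X : T -> R) : set (set T) :=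
  preimage_set_system [set: T] X measurable.

(* Processes are indexed by the times 0 <= t; values at t < 0 are ignored. *)
Definition sigma_process (X : R -> T -> R) : set (set T) :=
  <<s \bigcup_(t in [set t | 0 <= t]) sigma_var (X t) >>.

Definition independent_increments (X : R -> T -> R) : Prop :=
  forall (n : nat) (t : nat -> R),
    0 <= t 0%N -> {homo t : i j / (i <= j)%N >-> i <= j} ->
    mutually_independent
      (fun i : 'I_n => sigma_var (fun w => X (t i.+1) w - X (t i) w)).

Definition stationary_increments (X : R -> T -> R) : Prop :=
  forall (s h : R) (B : set R), 0 <= s -> 0 <= h -> measurable B ->
    P [set w | B (X (s + h) w - X s w)] = P [set w | B (X h w)].

Record monotone_process (X : R -> T -> R) : Prop := {
  mp_measurable : forall t, 0 <= t -> measurable_fun [set: T] (X t) ;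
  mp_start : forall w, X 0 w = 0 ;
  mp_nondecreasing : forall w s t, 0 <= s -> s <= t -> X s w <= X t w ;
  mp_right_continuous : forall w t, 0 <= t -> X u w @[u --> t^'+] --> X t w }.

Definition real_process (N : R -> T -> nat) : R -> T -> R :=
  fun t w => (N t w)%:R.

Record poisson_process (lambda : R) (N : R -> T -> nat) : Prop := {
  pp_process : monotone_process (real_process N) ;
  pp_independent : independent_increments (real_process N) ;
  pp_law : forall (s t : R) (n : nat), 0 <= s -> s < t ->
    P [set w | N t w = (N s w + n)%N] =
      (poisson_pmf (lambda * (t - s)) n)%:E }.

Record subordinator (D : R -> T -> R) : Prop := {
  sub_process : monotone_process D ;
  sub_independent : independent_increments D ;
  sub_stationary : stationary_increments D }.

Record tempered_stable_subordinator (alpha mu : R) (D : R -> T -> R) : Prop := {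
  tss_subordinator : subordinator D ;
  tss_laplace : forall s t : R, 0 <= s -> 0 <= t ->
    ('E_P[fun w => expR (- s * D t w)] =
      (expR (- t * ((s + mu) `^ alpha - mu `^ alpha)))%:E)%E }.

Definition independent_processes4 (X1 X2 X3 X4 : R -> T -> R) : Prop :=
  mutually_independent (fun i : 'I_4 =>
    nth set0 [:: sigma_process X1; sigma_process X2;
                 sigma_process X3; sigma_process X4] i).

Definition tempered_skellam (N1 N2 : R -> T -> nat) (D1 D2 : R -> T -> R)
    (t : R) (w : T) : int :=
  (N1 (D1 t w) w)%:Z - (N2 (D2 t w) w)%:Z.

Definition skellam_pmf (N1 N2 : R -> T -> nat) (D1 D2 : R -> T -> R)
    (k : int) (t : R) : R :=
  fine (P [set w | tempered_skellam N1 N2 D1 D2 t w = k]).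

End processes.

(* Main.v *)
Require Import Defs.
From HB Require Import structures.
From mathcomp Require Import all_boot all_order all_algebra.
From mathcomp Require Import all_classical all_reals all_analysis.
From mathcomp Require Import measurable_realfun zify ring lra.

Set Implicit Arguments.
Unset Strict Implicit.
Unset Printing Implicit Defensive.

Import Order.TTheory GRing.Theory Num.Theory.
Import numFieldNormedType.Exports.

Local Open Scope classical_set_scope.
Local Open Scope ring_scope.

(** Conditionally on the clock, a Poisson count at a tempered stable time [X]
    has the weights [(lambda X)^j / j! * exp (- lambda X)], so its law involves
    the moments [E (X^j exp (- lambda X))], that is, up to sign, the derivatives
    at [lambda] of the Laplace transform of [X]. That transform is
    [exp (t mu^alpha) f (s + mu)] with [f x = exp (- t x^alpha)]; hence the count
    is [j] with probability
    [(- lambda)^j / j! * exp (t mu^alpha) * f^(j) (lambda + mu)]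
    (lemmas [tempered_moment] and [tempered_poisson_weight]). The derivatives are
    obtained by comparing two power series ([power_series_eq0]).

    On the other side, a quotient [Gamma (1 + a) / Gamma (1 - n + a)] is the
    falling factorial [a (a - 1) ... (a - n + 1)] ([Gamma_fallr]), so the
    Fox-Wright function in the formula is [f] expanded in powers of [x^alpha],
    differentiated [j + m] times, taken at [lambda] and multiplied by
    [lambda^(j + m)]. Up to a factor [lambda^j] the series over [m] is therefore
    the Taylor series of [f^(j)] about [lambda], at distance [mu] ([fw_taylor], a
    consequence of the binomial series and of Tannery's theorem). Its sum is
    [f^(j) (lambda + mu)] when [mu < lambda].

    When [mu >= lambda] and [t > 0], the series over [m] cannot converge for every
    large [j], as the formula presupposes: Vandermonde's convolution gives
    Leibniz' rule for the derivatives of [f] ([fwS]), all of whose terms have the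
    same sign, and keeping one of them shows that for [j >= 2] the terms of the
    series do not tend to zero ([not_cvg_tsf]). For [t = 0] the series have at
    most one nonzero term. So the sum of the series is known in every case in
    which the formula is asserted ([lim_tsf]).

    It remains to see that the two counts are independent with the laws above
    ([joint_count_law]). The clocks are rounded up to a grid: they then take
    countably many values, and the product rule for the four processes applies to
    each pair of values. Refining the grid, the counts at the rounded clocks are
    eventually equal to the counts at the clocks, by right continuity of the
    paths, and the integrals converge by dominated convergence. The formula
    results from summing over the values [n + k] and [n] of the counts. *)

(** * Euler's Gamma function and falling factorials *)

Section euler_gamma.
Context {R : realType}.
Implicit Types (x u a b : R).
Local Notation mu := (@lebesgue_measure R).

Let gfun x u : R := u `^ (x - 1) * expR (- u).
Let J n := `[n.+2%:R^-1, n.+2%:R]%classic : set R.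

Lemma integral_derive_pos (F f : R -> R) a b : 0 < a -> a < b ->
  (forall u, 0 < u -> is_derive u 1 F (f u)) ->
  (forall u, 0 < u -> {for u, continuous f}) ->
  (\int[mu]_(u in `[a, b]) (f u)%:E = (F b - F a)%:E)%E.
Proof.
move=> a0 ab dF cf.
have cF u : 0 < u -> {for u, continuous F}.
  move=> /dF[dFu _].
  by apply: differentiable_continuous; exact/derivable1_diffP.
rewrite (@continuous_FTC2 _ f F)// .
- apply: continuous_in_subspaceT => u; rewrite inE/= in_itv/= => /andP[au _].
  exact/cf/(lt_le_trans a0).
- split.
  + move=> u; rewrite in_itv/= => /andP[au _].
    by have [] := dF u (lt_trans a0 au).
  + by apply: cvg_at_right_filter; exact: cF.
  + by apply: cvg_at_left_filter; apply: cF; exact: lt_trans ab.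
- move=> u; rewrite in_itv/= => /andP[au _].
  by rewrite derive1E; have [_ ->] := dF u (lt_trans a0 au).
Qed.

Let is_derive_expRM (c u : R) :
  is_derive u 1 (fun v : R => expR (c * v)) (c * expR (c * u)).
Proof.
have dl : is_derive u 1 (fun v : R => c * v) c.
  by have := is_deriveZ c (is_derive_id u (1 : R)); rewrite /GRing.scale/= mulr1.
by have := is_derive1_comp (is_derive_expR (c * u)) dl; rewrite mulrC.
Qed.

Let is_derive_gfun x u : 0 < u ->
  is_derive u 1 (gfun (x + 1)) (x * gfun x u - gfun (x + 1) u).
Proof.
move=> u0; rewrite /gfun addrK.
have := is_derive1_powR x u0 => d1.
have d2 : is_derive u 1 (fun v : R => expR (- v)) (- expR (- u)).
  by have := is_derive_expRM (-1) u; under eq_fun do rewrite mulN1r; rewrite !mulN1r.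
apply: (is_derive_eq (is_deriveM d1 d2)).
by rewrite /GRing.scale/=; ring.
Qed.

Let continuous_gfun x u : 0 < u -> {for u, continuous (gfun x)}.
Proof.
move=> u0; have := is_derive_gfun (x - 1) u0; rewrite subrK => -[d _].
by apply: differentiable_continuous; exact/derivable1_diffP.
Qed.

Let gfun_ge0 x u : 0 <= gfun x u.
Proof. by rewrite /gfun mulr_ge0 ?powR_ge0 ?expR_ge0. Qed.

Let measurable_gfun x (A : set R) :
  measurable_fun A (fun u => (gfun x u)%:E).
Proof.
apply/measurable_EFinP; apply: measurable_funTS.
by apply: measurable_funM; [exact: measurable_powR|apply: measurableT_comp].
Qed.

(* Integrating the derivative of [u `^ x * expR (- u)], the integrand of
   [euler_gamma (x + 1)]. *)
Let integral_gfunS x a b : 0 < a -> a < b ->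
  (\int[mu]_(u in `[a, b]) (gfun (x + 1) u)%:E =
   x%:E * \int[mu]_(u in `[a, b]) (gfun x u)%:E
   - (gfun (x + 1) b - gfun (x + 1) a)%:E)%E.
Proof.
move=> a0 ab.
have int y : mu.-integrable `[a, b] (EFin \o gfun y).
  apply: continuous_compact_integrable; first exact: segment_compact.
  apply: continuous_in_subspaceT => u; rewrite inE/= in_itv/= => /andP[au _].
  exact/continuous_gfun/(lt_le_trans a0).
have <- : (\int[mu]_(u in `[a, b]) (x * gfun x u - gfun (x + 1) u)%:E =
    (gfun (x + 1) b - gfun (x + 1) a)%:E)%E.
  apply: integral_derive_pos => // u u0; first exact: is_derive_gfun.
  apply: cvgB; last exact: continuous_gfun.
  by apply: cvgM; [exact: cvg_cst|exact: continuous_gfun].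
under [X in (_ = _ - X)%E]eq_integral do rewrite EFinB EFinM.
have intZ : mu.-integrable `[a, b] (fun u => x%:E * (gfun x u)%:E)%E.
  by apply: integrableZl => //; exact: int.
rewrite integralB//; last exact: int.
rewrite integralZl//; last exact: int.
rewrite oppeB; last first.
  by rewrite fin_num_adde_defl// fin_numN; apply: integrable_fin_num => //;
    exact: int.
rewrite addeA subee ?add0e//.
by apply: fin_numM => //; apply: integrable_fin_num => //; exact: int.
Qed.

(* An exponential bound at infinity: [u `^ x] is at most [1 + u ^+ N], and
   [u ^+ N] is dominated by [expR (u / 2)]. *)
Let gfun_le x : 0 < x -> exists2 C, 0 <= C &
  forall u, 0 < u -> gfun (x + 1) u <= C * expR (- (u / 2)).
Proof.
move=> x0; pose N := (Num.truncn x).+1.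
have xN : x <= N%:R by rewrite ltW// Num.Theory.truncnS_gt.
exists (1 + 2 ^+ N * N`!%:R) => [|u u0]; first by rewrite addr_ge0// mulr_ge0.
rewrite /gfun addrK.
have -> : expR (- u) = expR (- (u / 2)) * expR (- (u / 2)).
  by rewrite -expRD; congr expR; lra.
rewrite mulrA ler_wpM2r ?expR_ge0// expRN ler_pdivrMr ?expR_gt0//.
have e1 : 1 <= expR (u / 2) by rewrite -[leLHS]expR0 ler_expR divr_ge0 ?ltW.
have eN : u ^+ N <= 2 ^+ N * N`!%:R * expR (u / 2).
  have : 1 + (u / 2) ^+ N / N`!%:R <= expR (u / 2).
    by apply: expR_ge1Dxn; rewrite divr_ge0 ?ltW.
  move=> h; have {h} : (u / 2) ^+ N / N`!%:R <= expR (u / 2) by lra.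
  rewrite ler_pdivrMr ?ltr0n ?fact_gt0// expr_div_n ler_pdivrMr ?exprn_gt0//.
  by rewrite mulrC (mulrC _ N`!%:R) mulrA.
have [u1|u1] := leP u 1.
  apply: le_trans (_ : 1 * expR (u / 2) <= _).
    by rewrite mul1r (le_trans _ e1)// -(powRr0 u) ger_powR ?u0// ltW.
  by rewrite ler_wpM2r ?expR_ge0// lerDl mulr_ge0.
rewrite mulrDl mul1r (le_trans _ (lerD (expR_ge0 _) eN))// add0r.
by rewrite -(powR_mulrn _ (ltW u0)); apply: ler_powR => //; exact: ltW.
Qed.

Let bigcupJ : \bigcup_n J n = `]0, +oo[%classic.
Proof.
apply/seteqP; split=> [u [n _]|u]; rewrite /J /= !in_itv/= andbT.
  by move=> /andP[h _]; rewrite (lt_le_trans _ h)// invr_gt0.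
move=> u0; exists (Num.truncn (u + u^-1)) => //=; rewrite in_itv/=.
have h : u + u^-1 <= (Num.truncn (u + u^-1)).+2%:R.
  by rewrite (le_trans (ltW (Num.Theory.truncnS_gt _)))// ler_nat.
have ui : 0 < u^-1 by rewrite invr_gt0.
apply/andP; split; last by lra.
by rewrite invf_ple ?posrE//; lra.
Qed.

Let nndJ : nondecreasing_seq J.
Proof.
apply/nondecreasing_seqP => n; rewrite subsetEset /J => u /=.
rewrite !in_itv/= => /andP[h1 h2]; apply/andP; split.
  by apply: le_trans h1; rewrite lef_pV2 ?posrE// ler_nat.
by apply: le_trans h2 _; rewrite ler_nat.
Qed.

Let cvg_integral_gfun x :
  (\int[mu]_(u in J n) (gfun x u)%:E @[n --> \oo] -->
   \int[mu]_(u in `]0%R, +oo[) (gfun x u)%:E)%E.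
Proof.
rewrite -bigcupJ; apply: ge0_nondecreasing_set_cvg_integral => //.
- by move=> i; rewrite /J.
- by move=> i; exact: measurable_gfun.
- by move=> i u _; rewrite lee_fin.
Qed.

Let J01 n : 0 < n.+2%:R^-1 :> R /\ n.+2%:R^-1 < n.+2%:R :> R.
Proof.
split=> //; rewrite invf_plt ?posrE//.
by rewrite (@le_lt_trans _ _ 1) ?ltr1n// invf_le1// ler1n.
Qed.

Let integral_gfunS_fin x : 0 < x ->
  (\int[mu]_(u in `]0%R, +oo[) (gfun (x + 1) u)%:E < +oo)%E.
Proof.
move=> x0; have [C C0 hC] := gfun_le x0.
apply: (@le_lt_trans _ _ (C * 2)%:E); last exact: ltry.
have cg := @cvg_integral_gfun (x + 1).
rewrite -(cvg_lim _ cg)//; apply: lime_le; first exact: (cvgP _ cg).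
apply: nearW => n; have [J0 J1] := J01 n.
apply: (@le_trans _ _ (\int[mu]_(u in J n) (C * expR (- (u / 2)))%:E)%E).
  apply: ge0_le_integral => //.
  - by rewrite /J.
  - by move=> u _; rewrite lee_fin.
  - exact: measurable_gfun.
  - apply/measurable_EFinP; apply: measurable_funTS.
    apply: measurable_funM => //; apply: measurableT_comp => //.
    by apply: measurableT_comp => //; exact: measurable_funM.
  - move=> u; rewrite /J/= in_itv/= => /andP[ju _]; rewrite lee_fin hC//.
    exact: lt_le_trans ju.
have dE u : is_derive u 1 (fun v : R => C * (- 2 * expR (- (v / 2))))
    (C * expR (- (u / 2))).
  have h := is_deriveZ (C * - 2) (is_derive_expRM (- 2^-1) u).
  have E v : expR (- 2^-1 * v) = expR (- (v / 2)).
    by rewrite mulNr (mulrC 2^-1).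
  set G := (X in is_derive _ _ X _).
  have -> : G = (C * - 2) \*: (fun v => expR (- 2^-1 * v)).
    by apply/funext => v; rewrite /G /GRing.scale/= E mulrA.
  by apply: (is_derive_eq h); rewrite E /GRing.scale/=; field.
rewrite /J (@integral_derive_pos (fun v : R => C * (- 2 * expR (- (v / 2)))))//.
  rewrite lee_fin -mulrBr ler_wpM2l//.
  have := expR_ge0 (- (n.+2%:R / 2) : R).
  have : expR (- (n.+2%:R^-1 / 2)) <= 1 :> R.
    by rewrite -[leRHS]expR0 ler_expR lerNl oppr0 divr_ge0.
  by lra.
move=> u _; apply: cvgM; first exact: cvg_cst.
apply: continuous_comp; last exact: continuous_expR.
apply: cvgN; apply: cvgM; [exact: cvg_id|exact: cvg_cst].
Qed.

Let cvg_gfun_top x : 0 < x -> gfun (x + 1) n.+2%:R @[n --> \oo] --> 0.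
Proof.
move=> x0; have [C C0 hC] := gfun_le x0.
apply: (@squeeze_cvgr _ _ _ _ (cst 0) (fun n : nat => C * 2 * n.+1%:R^-1)).
- apply: nearW => n; rewrite gfun_ge0/=.
  apply: (le_trans (hC _ _)) => //; rewrite -mulrA ler_wpM2l//.
  rewrite expRN -[leRHS]invf_div lef_pV2 ?posrE ?expR_gt0 ?divr_gt0//.
  have := expR_ge1Dx (n.+2%:R / 2 : R).
  have : n.+1%:R <= n.+2%:R :> R by rewrite ler_nat.
  by lra.
- exact: cvg_cst.
- rewrite -[X in _ --> X](mulr0 (C * 2)); apply: cvgM; first exact: cvg_cst.
  exact: cvg_harmonic.
Qed.

Let cvg_gfun_bot x : 0 < x -> gfun (x + 1) n.+2%:R^-1 @[n --> \oo] --> 0.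
Proof.
move=> x0.
have h : n.+2%:R^-1 `^ x @[n --> \oo] --> (0 : R).
  have /cvg_at_rightP := powR_cvg0 x0; apply; split => //.
  have := @cvg_harmonic R; rewrite -cvg_shiftS; exact.
apply: (@squeeze_cvgr _ _ _ _ (cst 0) (fun n : nat => n.+2%:R^-1 `^ x)) => //.
  apply: nearW => n; rewrite gfun_ge0/= /gfun addrK.
  by rewrite ler_piMr ?powR_ge0// -[leRHS]expR0 ler_expR lerNl oppr0.
exact: cvg_cst.
Qed.

Let integral_gfunS_oo x : 0 < x ->
  (x%:E * \int[mu]_(u in `]0%R, +oo[) (gfun x u)%:E =
   \int[mu]_(u in `]0%R, +oo[) (gfun (x + 1) u)%:E)%E.
Proof.
move=> x0.
have h1 : (x%:E * \int[mu]_(u in J n) (gfun x u)%:E @[n --> \oo] -->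
    x%:E * \int[mu]_(u in `]0%R, +oo[) (gfun x u)%:E)%E.
  by apply: cvgeZl => //; exact: cvg_integral_gfun.
apply: (cvg_unique _ h1) => //.
have h2 : (\int[mu]_(u in J n) (gfun (x + 1) u)%:E +
    (gfun (x + 1) n.+2%:R - gfun (x + 1) n.+2%:R^-1)%:E @[n --> \oo] -->
    \int[mu]_(u in `]0%R, +oo[) (gfun (x + 1) u)%:E + 0%:E)%E.
  apply: cvgeD; first by rewrite fin_num_adde_defl.
    exact: cvg_integral_gfun.
  apply: cvg_EFin; first exact: nearW.
  rewrite -[X in _ --> X](subr0 (0:R)); apply: cvgB.
    exact: cvg_gfun_top.
  exact: cvg_gfun_bot.
rewrite adde0 in h2; apply: cvg_trans h2; apply: near_eq_cvg.
apply: nearW => n; have [J0 J1] := J01 n; rewrite /J integral_gfunS//.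
by rewrite subeK.
Qed.

(** The integration by parts is done on compact intervals exhausting the
    half-line, away from the singularity at 0; the boundary values
    [u `^ x * expR (- u)] vanish at both ends, which carries the identity over to
    the possibly infinite integrals. The one for [x + 1] is finite, hence so is
    the one for [x]. *)
Lemma euler_gammaS x : 0 < x -> euler_gamma (x + 1) = x * euler_gamma x.
Proof.
move=> x0.
have := integral_gfunS_fin x0; rewrite /euler_gamma /Rintegral.
rewrite -(integral_gfunS_oo x0).
have : (0 <= \int[mu]_(u in `]0%R, +oo[) (gfun x u)%:E)%E.
  by apply: integral_ge0 => u _; rewrite lee_fin.
rewrite /gfun.
case: (\int[mu]_(u in `]0%R, +oo[) _)%E => [r _ _ //|_|//].
by rewrite gt0_muley ?lte_fin.
Qed.

Lemma euler_gamma_gt0 x : 0 < x -> 0 < euler_gamma x.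
Proof.
move=> x0.
suff h (y : R) : 1 < y -> 0 < euler_gamma y.
  by have := h (x + 1); rewrite ltrDr euler_gammaS// pmulr_rgt0//; exact.
move=> y1.
have fin : (\int[mu]_(u in `]0%R, +oo[) (gfun y u)%:E < +oo)%E.
  by have := @integral_gfunS_fin (y - 1); rewrite subrK subr_gt0; exact.
rewrite /euler_gamma /Rintegral fine_gt0// -/(gfun _) fin andbT.
have le1 : (\int[mu]_(u in `[1%R, 2%R]) (expR (- 2))%:E <=
    \int[mu]_(u in `]0%R, +oo[) (gfun y u)%:E)%E.
  apply: (@le_trans _ _ (\int[mu]_(u in `[1%R, 2%R]) (gfun y u)%:E)%E).
    apply: ge0_le_integral => //.
    - exact: measurable_gfun.
    - move=> u; rewrite /= in_itv/= => /andP[u1 u2]; rewrite lee_fin /gfun.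
      rewrite -[leLHS]mul1r ler_pM ?expR_ge0// ?ler_expR ?lerN2//.
      by rewrite -[leLHS](powRr0 u) ler_powR// subr_ge0 ltW.
  apply: ge0_subset_integral => //.
  - exact: measurable_gfun.
  - by move=> u _; rewrite lee_fin.
  - move=> u /=; rewrite !in_itv/= andbT => /andP[u1 _].
    exact: lt_le_trans u1.
apply: lt_le_trans le1; rewrite integral_cst//= lebesgue_measure_itv/=.
by rewrite lte_fin ltr1n/= -EFinB -EFinM lte_fin mulr_gt0 ?expR_gt0//; lra.
Qed.

End euler_gamma.

Section gamma_ratio.
Context {R : realType}.
Implicit Types (a y : R) (n : nat).

Definition fallr a n : R := \prod_(0 <= i < n) (a - i%:R).

Lemma fallr0 a : fallr a 0 = 1.
Proof. by rewrite /fallr big_nil. Qed.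

Lemma fallrS a n : fallr a n.+1 = fallr a n * (a - n%:R).
Proof. by rewrite /fallr big_nat_recr. Qed.

Lemma euler_gamma_addn y n : 0 < y ->
  euler_gamma (y + n%:R) = \prod_(0 <= i < n) (y + i%:R) * euler_gamma y.
Proof.
move=> y0; elim: n => [|n IH]; first by rewrite addr0 big_nil mul1r.
have yn : 0 < y + n%:R by rewrite ltr_wpDr.
rewrite -natr1 addrA (euler_gammaS yn) IH big_nat_recr//=.
by rewrite mulrCA mulrA.
Qed.

(** The functional equation climbs from [1 - n%:R + a] to [1 + a] in [n] steps.
    At a pole of the denominator the convention on [Gamma] gives 0, in
    agreement with the vanishing factor of the falling factorial. *)
Lemma Gamma_fallr a n : 0 <= a ->
  Gamma (1 + a) / Gamma (1 - n%:R + a) = fallr a n.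
Proof.
move=> a0; set y := 1 - n%:R + a.
have ay : 1 + a = y + n%:R by rewrite /y; ring.
have -> : fallr a n = \prod_(0 <= i < n) (y + i%:R).
  rewrite /fallr big_nat_rev/= add0n; apply: eq_big_nat => i /andP[_ ni].
  by rewrite natrB// /y -natr1; ring.
rewrite {1}/Gamma ltr_wpDr// ay /Gamma.
have [y0|y0] := ltP 0 y.
  by rewrite euler_gamma_addn// mulfK// gt_eqF// euler_gamma_gt0.
set N := (Num.truncn (- y)).+1.
have yN : 0 < y + N%:R by have := Num.Theory.truncnS_gt (- y); rewrite -/N; lra.
have Nn : (N <= n)%N.
  rewrite /N -(@ltr_nat R) (@le_lt_trans _ _ (- y))//; last by rewrite /y; lra.
  by rewrite Num.Theory.truncn_le oppr_ge0.
rewrite -{1}(subnKC Nn) natrD addrA (euler_gamma_addn _ yN) invf_div mulrA.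
rewrite [_ * _ * \prod_(_ <= _ < _) _]mulrAC mulfK ?gt_eqF ?euler_gamma_gt0//.
rewrite (@big_cat_nat _ 1 *%R N 0 n)//= mulrC; congr (_ * _).
rewrite -[in RHS](add0n N) big_addn; apply: eq_big_nat => i _.
by rewrite natrD addrAC addrA.
Qed.

End gamma_ratio.

(** * Dominated series and uniqueness of power series *)

Section dominated_series.
Context {R : realType}.
Implicit Types (u v : R ^nat) (f : nat -> R ^nat).

Lemma cvg_series_dominated u v : (forall n, `|u n| <= v n) ->
  cvgn (series v) -> cvgn (series u).
Proof.
move=> uv cv; apply: normed_cvg.
apply: series_le_cvg cv => [n|n|//]; first exact: normr_ge0.
exact: le_trans _ (uv n).
Qed.

Lemma series_tail_dominated u v n : (forall n, `|u n| <= v n) ->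
  cvgn (series v) ->
  `|limn (series u) - series u n| <= limn (series v) - series v n.
Proof.
move=> uv cv; have cu := cvg_series_dominated uv cv.
have cl : `|series u k - series u n| @[k --> \oo] --> `|limn (series u) - series u n|.
  by apply: cvg_norm; apply: cvgB => //; exact: cvg_cst.
rewrite -(cvg_lim _ cl)//; apply: limr_le; first exact: (cvgP _ cl).
near=> k.
have nk : (n <= k)%N by near: k; exact: nbhs_infty_ge.
apply: (@le_trans _ _ (series v k - series v n)).
  rewrite !sub_series_geq//.
  by apply: (le_trans (ler_norm_sum _ _ _)); exact: ler_sum.
rewrite lerB//; apply: nondecreasing_cvgn_le => //.
by apply: nondecreasing_series => m _ _; exact: le_trans _ (uv m).
Unshelve. all: by end_near. Qed.

(** Tannery's theorem: dominated convergence for series. *)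
Lemma tannery f (s v : R ^nat) : cvgn (series v) ->
  (forall n r, `|f n r| <= v r) -> (forall r, f n r @[n --> \oo] --> s r) ->
  cvgn (series s) /\ limn (series (f n)) @[n --> \oo] --> limn (series s).
Proof.
move=> cv fv fs.
have sv r : `|s r| <= v r.
  have cl : `|f n r| @[n --> \oo] --> `|s r| by apply: cvg_norm; exact: fs.
  rewrite -(cvg_lim _ cl)//.
  by apply: limr_le; [exact: (cvgP _ cl)|exact: nearW].
split; first exact: cvg_series_dominated sv cv.
apply/cvgrPdist_lt => e e0.
have e3 : 0 < e / 3 by rewrite divr_gt0.
have /cvgrPdist_lt/(_ _ e3)[N _ hN] := cv.
have tN : limn (series v) - series v N < e / 3.
  by apply: le_lt_trans (hN N _); [exact: ler_norm|exact: leqnn].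
have cN : series (f n) N @[n --> \oo] --> series s N.
  rewrite /series/=; apply: cvg_big => [|r _]; [exact: add_continuous|exact: fs].
near=> n.
have h1 := series_tail_dominated N sv cv.
have h2 := series_tail_dominated N (fv n) cv.
have h3 : `|series s N - series (f n) N| < e / 3.
  by near: n; move/cvgrPdist_lt : cN => /(_ _ e3).
have -> : limn (series s) - limn (series (f n)) =
    (limn (series s) - series s N) + (series s N - series (f n) N)
    - (limn (series (f n)) - series (f n) N) by ring.
apply: (le_lt_trans (ler_normB _ _)).
apply: (le_lt_trans (lerD (ler_normD _ _) (lexx _))).
by lra.
Unshelve. all: by end_near. Qed.

Lemma cvg_series_scale u (c l : R) : series u @ \oo --> l ->
  series (fun n => c * u n) @ \oo --> c * l.
Proof.
move=> h; have h2 : c * series u n @[n --> \oo] --> c * l by exact: cvgMl_tmp.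
apply: cvg_trans h2; apply: near_eq_cvg; apply: nearW => n.
by rewrite /series/= mulr_sumr.
Qed.

Lemma cvg_series_exp_geom (c : R) :
  series (fun r => c ^+ r / r`!%:R) @ \oo --> expR c.
Proof. exact: (is_cvg_series_exp_coeff c). Qed.

(** A power series vanishing on a right neighbourhood of 0 is zero: its first
    nonzero coefficient would dominate the rest. *)
Lemma power_series_eq0 (c : R ^nat) (rho : R) : 0 < rho ->
  (forall h, 0 < h < rho -> series (fun m => c m * h ^+ m) @ \oo --> (0 : R)) ->
  forall m, c m = 0.
Proof.
move=> rho0 ch; apply: ltn_ind => m IH.
pose h0 := rho / 2; have h00 : 0 < h0 by rewrite divr_gt0.
have h0r : h0 < rho by rewrite /h0; lra.
have /cvgP/cvg_series_bounded[K [Kr hK]] := ch h0 (introT andP (conj h00 h0r)).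
pose C := `|K| + 1.
have cC i : `|c i| * h0 ^+ i <= C.
  rewrite -[X in _ * X]ger0_norm ?exprn_ge0 ?(ltW h00)// -normrM.
  by apply: hK => //; rewrite /C; have := ler_norm K; lra.
have C0 : 0 < C by rewrite /C; have := normr_ge0 K; lra.
(* With [h = q * h0], the terms after the m-th add up to at most the geometric
   sum [C * q ^+ m.+1 / (1 - q)], and they must cancel the m-th. *)
have key q : 0 < q < 2^-1 -> `|c m| * h0 ^+ m <= 2 * C * q.
  move=> /andP[q0 q1]; pose h := q * h0.
  have hh : 0 < h < rho by rewrite /h mulr_gt0//= /h0; nra.
  have hp : 0 < h by case/andP: hh.
  pose w i := c (i + m.+1)%N * h ^+ (i + m.+1).
  pose g := geometric (C * q ^+ m.+1) q.
  have wg i : `|w i| <= g i.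
    rewrite /w /g /geometric/= normrM normrX (gtr0_norm hp) /h exprMn.
    have -> : C * q ^+ m.+1 * q ^+ i = C * q ^+ (i + m.+1).
      by rewrite addnC exprD mulrA.
    by rewrite mulrCA [leRHS]mulrC ler_wpM2l ?exprn_ge0 ?(ltW q0).
  have cg : series g @ \oo --> C * q ^+ m.+1 * (1 - q)^-1.
    by apply: cvg_geometric_series; rewrite gtr0_norm//; lra.
  have cw : series w @ \oo --> - (c m * h ^+ m).
    have := ch h hh; rewrite -(cvg_shiftn m.+1) /= => cs.
    rewrite -[X in _ --> X]add0r.
    have cB : series (fun k => c k * h ^+ k) (n + m.+1)%N - c m * h ^+ m
        @[n --> \oo] --> 0 - c m * h ^+ m.
      by apply: cvgB; [exact: cs|exact: cvg_cst].
    apply: cvg_trans cB.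
    apply: near_eq_cvg; apply: nearW => n /=; rewrite /series/=.
    rewrite (@big_cat_nat _ _ _ m.+1)//=; last by rewrite leq_addl.
    rewrite big_nat_recr//= big_nat_cond big1 ?add0r; last first.
      by move=> i /andP[/andP[_ im] _]; rewrite IH// mul0r.
    rewrite addrAC subrr add0r -{1}[m.+1]add0n big_addn addnK.
    by apply: eq_bigr.
  have : `|c m * h ^+ m| <= C * q ^+ m.+1 * (1 - q)^-1.
    rewrite -normrN -(cvg_lim _ cw)// -(cvg_lim _ cg)//.
    have := @series_tail_dominated w g 0 wg (cvgP _ cg).
    by rewrite /series/= !big_geq// !subr0.
  rewrite normrM normrX (gtr0_norm hp) /h exprMn exprS mulrCA.
  have -> : C * (q * q ^+ m) * (1 - q)^-1 = q ^+ m * (C * q * (1 - q)^-1).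
    by rewrite (mulrC q) mulrCA -!mulrA.
  rewrite ler_pM2l ?exprn_gt0// => H.
  apply: (le_trans H); have -> : 2 * C * q = C * q * 2 by ring.
  rewrite ler_wpM2l ?mulr_ge0 ?(ltW C0) ?(ltW q0)//.
  rewrite -[leRHS]invrK lef_pV2 ?posrE; lra.
have : `|c m| * h0 ^+ m <= 0.
  rewrite leNgt; apply/negP => p0.
  set p := `|c m| * h0 ^+ m in p0 key *.
  pose q := Num.min 4^-1 (p / (4 * C)).
  have q0 : 0 < q by rewrite lt_min invr_gt0 ltr0n/= divr_gt0// mulr_gt0.
  have q1 : q < 2^-1 by rewrite /q gt_min ltf_pV2 ?posrE// ltr_nat.
  have := key q (introT andP (conj q0 q1)).
  have : q <= p / (4 * C) by rewrite ge_min lexx orbT.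
  rewrite ler_pdivlMr ?mulr_gt0//; nra.
rewrite pmulr_lle0 ?exprn_gt0// => h; apply/eqP.
by rewrite -normr_eq0 eq_le h normr_ge0.
Qed.

End dominated_series.

(** * Bounds and convolution for falling factorials *)

Section falling_factorial.
Context {R : realType}.
Implicit Types (a b y z rho alpha : R) (m n r : nat).

Definition raisr a n : R := \prod_(0 <= i < n) (a + i%:R).

Lemma raisrS a n : raisr a n.+1 = raisr a n * (a + n%:R).
Proof. by rewrite /raisr big_nat_recr. Qed.

Lemma raisrSl a n : raisr a n.+1 = a * raisr (a + 1) n.
Proof.
rewrite /raisr big_nat_recl//= addr0; congr (_ * _).
by apply: eq_bigr => i _; rewrite -natr1; ring.
Qed.

Lemma raisr0 n : raisr 0 n = (n == 0%N)%:R.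
Proof.
case: n => [|n]; first by rewrite /raisr big_nil.
by rewrite raisrSl mul0r.
Qed.

Lemma raisr_ge0 a n : 0 <= a -> 0 <= raisr a n.
Proof. by move=> a0; apply: prodr_ge0 => i _; rewrite addr_ge0. Qed.

Lemma raisrD a m n : raisr a (m + n) = raisr a m * raisr (a + m%:R) n.
Proof.
elim: n => [|n IH]; first by rewrite addn0 /raisr [in X in _ * X]big_nil mulr1.
by rewrite addnS !raisrS IH natrD mulrA addrA.
Qed.

Lemma fallrSl a n : fallr a n.+1 = a * fallr (a - 1) n.
Proof.
rewrite /fallr big_nat_recl//= subr0; congr (_ * _).
by apply: eq_bigr => i _; rewrite -natr1; ring.
Qed.

Lemma fallrD a m n : fallr a (m + n) = fallr a m * fallr (a - m%:R) n.
Proof.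
elim: n => [|n IH]; first by rewrite addn0 fallr0 mulr1.
by rewrite addnS !fallrS IH natrD mulrA opprD addrA.
Qed.

Lemma normr_fallr_le a b n : `|a| <= b -> `|fallr a n| <= raisr b n.
Proof.
move=> ab; rewrite /fallr normr_prod; apply: ler_prod => i _.
rewrite normr_ge0/= (le_trans (ler_normB _ _))// lerD//.
by rewrite ger0_norm.
Qed.

Lemma fallrN a n : fallr (- a) n = (-1) ^+ n * raisr a n.
Proof.
elim: n => [|n IH]; first by rewrite fallr0 /raisr big_nil expr0 mulr1.
by rewrite fallrS IH raisrS exprS; ring.
Qed.

(** The partial sums of the expansion of [(1 - rho) ^- A] lie below it: by
    Pascal's rule, multiplying them by [1 - rho] lowers [A] by one. *)
Lemma sum_raisr_le (A M : nat) rho : 0 <= rho < 1 ->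
  \sum_(0 <= m < M) raisr A%:R m / m`!%:R * rho ^+ m <= (1 - rho) ^- A.
Proof.
move=> /andP[r0 r1]; have r10 : 0 < 1 - rho by lra.
pose S A M := \sum_(0 <= m < M) raisr A%:R m / m`!%:R * rho ^+ m.
rewrite -/(S A M); elim: A M => [|A IH] M.
  case: M => [|M]; first by rewrite /S big_nil expr0 invr1.
  rewrite /S big_nat_recl//= big1 ?addr0; last by move=> i _; rewrite raisr0 !mul0r.
  by rewrite raisr0 fact0 !expr0 !invr1 !mulr1.
suff step M' : (1 - rho) * S A.+1 M' <= S A M'.
  rewrite exprS invfM -ler_pdivrMl ?invr_gt0// invrK.
  exact: le_trans (step M) (IH M).
case: M' => [|M']; first by rewrite /S !big_nil mulr0.
have -> : S A M'.+1 = (1 - rho) * S A.+1 M'.+1 +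
    rho ^+ M'.+1 * (raisr A.+1%:R M' / M'`!%:R).
  elim: M' => [|M' IHM].
    by rewrite /S !big_nat1 !fact0 /raisr !big_nil expr0 expr1; ring.
  rewrite /S big_nat_recr//= -/(S _ _) IHM /S [in RHS]big_nat_recr//= -/(S _ _).
  rewrite -natr1 raisrSl [raisr (A%:R + 1) M'.+1]raisrS factS natrM !exprS.
  have f0 : M'`!%:R != 0 :> R by rewrite pnatr_eq0 -lt0n fact_gt0.
  have M0 : M'.+1%:R != 0 :> R by rewrite pnatr_eq0.
  rewrite -[M'.+1%:R]natr1 in M0 *.
  by field; rewrite f0 M0.
rewrite lerDl mulr_ge0 ?exprn_ge0// mulr_ge0 ?invr_ge0 ?ler0n//.
exact: raisr_ge0.
Qed.

(** The previous bound at [rho = 1/2], keeping a single term. *)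
Lemma raisr_nat_le (A n : nat) : raisr A%:R n <= n`!%:R * 2 ^+ (A + n) :> R.
Proof.
have : raisr A%:R n / n`!%:R * 2^-1 ^+ n <= 2 ^+ A :> R.
  have E : (1 - 2^-1 : R) ^- A = 2 ^+ A.
    by rewrite -exprVn; congr (_ ^+ _); field.
  rewrite -E; apply: le_trans; last first.
    apply: (@sum_raisr_le A n.+1 2^-1); lra.
  rewrite big_nat_recr//= lerDr; apply: sumr_ge0 => i _.
  by rewrite mulr_ge0 ?exprn_ge0 ?invr_ge0// divr_ge0 ?raisr_ge0.
rewrite exprVn -mulrA -invfM ler_pdivrMr ?mulr_gt0 ?exprn_gt0 ?ltr0n ?fact_gt0//.
by rewrite exprD mulrCA.
Qed.

(** Pascal's rule in convolution form. *)
Lemma sum_binS (F : nat -> nat -> R) n :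
  \sum_(0 <= i < n.+2) 'C(n.+1, i)%:R * F i (n.+1 - i)%N =
  \sum_(0 <= i < n.+1) 'C(n, i)%:R * (F i.+1 (n - i)%N + F i (n.+1 - i)%N).
Proof.
under [RHS]eq_bigr do rewrite mulrDr.
rewrite big_split/=.
have -> : \sum_(0 <= i < n.+1) 'C(n, i)%:R * F i (n.+1 - i)%N =
    F 0%N n.+1 + \sum_(0 <= i < n.+1) 'C(n, i.+1)%:R * F i.+1 (n - i)%N.
  transitivity (\sum_(0 <= i < n.+2) 'C(n, i)%:R * F i (n.+1 - i)%N).
    by rewrite [RHS]big_nat_recr//= bin_small// mul0r addr0.
  by rewrite big_nat_recl//= bin0 mul1r.
rewrite big_nat_recl//= bin0 mul1r addrCA -big_split/=; congr (_ + _).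
by apply: eq_bigr => i _; rewrite binS natrD mulrDl addrC.
Qed.

Lemma fallr_vandermonde a b n : fallr (a + b) n =
  \sum_(0 <= i < n.+1) 'C(n, i)%:R * (fallr a i * fallr b (n - i)).
Proof.
elim: n => [|n IH]; first by rewrite big_nat1 !fallr0 bin0 !mulr1.
rewrite fallrS IH mulr_suml (sum_binS (fun i j => fallr a i * fallr b j)).
apply: eq_big_nat => i /andP[_ ni]; rewrite subSn// !fallrS natrB//.
by ring.
Qed.

End falling_factorial.

(** * The Fox-Wright series as derivatives of exp (- t x^alpha) *)

Section fox_wright_values.
Context {R : realType}.
Implicit Types (a b y z rho alpha : R) (m n r : nat).

Let fw_term alpha n z r : R := fallr (alpha * r%:R) n * (z ^+ r / r`!%:R).

(** For [z = - t x^alpha] this is [x^n] times the [n]-th derivative in [x] of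
    [exp (- t x^alpha)], differentiated term by term. *)
Definition fw alpha n z : R := limn (series (fw_term alpha n z)).

Let fw_term_le alpha n z r : 0 <= alpha <= 1 ->
  `|fw_term alpha n z r| <=
    n`!%:R * 2 ^+ n * ((2 * `|z|) ^+ r / r`!%:R).
Proof.
move=> /andP[a0 a1].
have h : `|fallr (alpha * r%:R) n| <= n`!%:R * 2 ^+ n * 2 ^+ r.
  apply: (@le_trans _ _ (raisr r%:R n)).
    by apply: normr_fallr_le; rewrite ger0_norm ?mulr_ge0// ler_piMl.
  by rewrite (le_trans (raisr_nat_le _ _))// exprD mulrA mulrAC.
rewrite /fw_term normrM normrM normrX normfV [`|r`!%:R|]ger0_norm//.
rewrite exprMn -[2 ^+ r * _ * _]mulrA [leRHS]mulrA.
by rewrite ler_wpM2r ?mulr_ge0 ?invr_ge0 ?exprn_ge0.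
Qed.

Lemma cvg_fw alpha n z : 0 <= alpha <= 1 ->
  series (fw_term alpha n z) @ \oo --> fw alpha n z.
Proof.
move=> a01; suff : cvgn (series (fw_term alpha n z)) by [].
apply: (cvg_series_dominated (fun r => fw_term_le n z r a01)).
apply/cvg_ex; exists (n`!%:R * 2 ^+ n * expR (2 * `|z|)).
by apply: cvg_series_scale; exact: cvg_series_exp_geom.
Qed.

(** The quotient of Gamma values in the Fox-Wright series is a falling
    factorial. *)
Lemma fox_wrightE alpha j m z : 0 <= alpha ->
  fox_wright 1 alpha (1 - j%:R - m%:R) alpha z = fw alpha (j + m) z.
Proof.
move=> a0; rewrite /fox_wright /fw; congr (limn (series _)).
apply/funext => r; rewrite /fw_term -Gamma_fallr ?mulr_ge0//.
by rewrite natrD opprD addrA.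
Qed.

Lemma fw0 alpha z : fw alpha 0 z = expR z.
Proof.
rewrite /fw -(cvg_lim _ (@cvg_series_exp_geom _ z))//.
by congr (limn (series _)); apply/funext => r; rewrite /fw_term fallr0 mul1r.
Qed.

(** Vandermonde's convolution, applied to [alpha * r.+1 - 1 =
    (alpha - 1) + alpha * r], turns a shift of the summation index into Leibniz'
    rule for the derivative [- t alpha x^(alpha - 1) exp (- t x^alpha)]. *)
Lemma fwS alpha n z : 0 <= alpha <= 1 -> fw alpha n.+1 z =
  alpha * z * \sum_(0 <= i < n.+1)
    'C(n, i)%:R * (fallr (alpha - 1) i * fw alpha (n - i) z).
Proof.
move=> a01; have := @cvg_fw alpha n.+1 z a01; rewrite -cvg_shiftS => h.
rewrite -(cvg_lim _ h)//; apply/cvg_lim => //.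
have cs : alpha * z * \sum_(0 <= i < n.+1)
    'C(n, i)%:R * (fallr (alpha - 1) i * series (fw_term alpha (n - i) z) N)
    @[N --> \oo] --> alpha * z * \sum_(0 <= i < n.+1)
    'C(n, i)%:R * (fallr (alpha - 1) i * fw alpha (n - i) z).
  apply: cvgMl_tmp; apply: cvg_big => [|i _]; first exact: add_continuous.
  by apply: cvgMl_tmp; apply: cvgMl_tmp; exact: cvg_fw.
apply: cvg_trans cs; apply: near_eq_cvg; apply: nearW => N.
have t0 : fw_term alpha n.+1 z 0 = 0 by rewrite /fw_term mulr0 fallrSl !mul0r.
rewrite /series/= [RHS]big_nat_recl//= t0 add0r.
under eq_bigr do rewrite mulr_sumr mulr_sumr.
rewrite exchange_big/= mulr_sumr; apply: eq_bigr => r _; symmetry.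
rewrite /fw_term fallrSl.
have -> : alpha * r.+1%:R - 1 = (alpha - 1) + alpha * r%:R by rewrite -natr1; ring.
rewrite fallr_vandermonde.
have -> : z ^+ r.+1 / r.+1`!%:R = z / r.+1%:R * (z ^+ r / r`!%:R).
  by rewrite factS natrM invfM exprS; ring.
have -> : alpha * r.+1%:R * (\sum_(0 <= i < n.+1) 'C(n, i)%:R *
    (fallr (alpha - 1) i * fallr (alpha * r%:R) (n - i))) *
    (z / r.+1%:R * (z ^+ r / r`!%:R)) =
  alpha * z * ((\sum_(0 <= i < n.+1) 'C(n, i)%:R *
    (fallr (alpha - 1) i * fallr (alpha * r%:R) (n - i))) * (z ^+ r / r`!%:R)).
  have r0 : r.+1%:R != 0 :> R by rewrite pnatr_eq0.
  have f0 : r`!%:R != 0 :> R by rewrite pnatr_eq0 -lt0n fact_gt0.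
  by field; rewrite f0 [1 + _]addrC natr1 r0.
congr (_ * _); rewrite mulr_suml; apply: eq_bigr => i _.
by rewrite !mulrA.
Qed.

Let signed_fallr alpha i : (-1) ^+ i * fallr (alpha - 1) i = raisr (1 - alpha) i.
Proof.
by rewrite -[alpha - 1]opprB fallrN mulrA -exprMn mulrNN mulr1 expr1n mul1r.
Qed.

Let signed_fwS alpha n z : 0 <= alpha <= 1 ->
  (-1) ^+ n.+1 * fw alpha n.+1 z = alpha * (- z) * \sum_(0 <= i < n.+1)
    'C(n, i)%:R * (raisr (1 - alpha) i * ((-1) ^+ (n - i) * fw alpha (n - i) z)).
Proof.
move=> a01; rewrite fwS// exprS !mulr_sumr.
apply: eq_big_nat => i /andP[_ ni]; rewrite -signed_fallr.
have -> : (-1) ^+ n = (-1) ^+ i * (-1) ^+ (n - i) :> R.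
  by rewrite -exprD subnKC.
by ring.
Qed.

(** All the terms of the recursion have the same sign: [exp (- t x^alpha)] is
    completely monotone. *)
Lemma fw_alternate alpha n z : 0 < alpha < 1 -> z <= 0 ->
  0 <= (-1) ^+ n * fw alpha n z.
Proof.
move=> /andP[a0 a1] z0; elim/ltn_ind: n => -[|n] IH.
  by rewrite fw0 expr0 mul1r expR_ge0.
rewrite signed_fwS ?(ltW a0) ?(ltW a1)//.
rewrite mulr_ge0//; first by rewrite mulr_ge0 ?(ltW a0)// oppr_ge0.
rewrite big_nat_cond; apply: sumr_ge0 => i /andP[/andP[_ ni] _].
rewrite mulr_ge0// mulr_ge0//; first by rewrite raisr_ge0// subr_ge0 ltW.
by rewrite IH// ltnS leq_subr.
Qed.

(** Of the terms of the recursion, only the last is kept. *)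
Lemma fw_alternateS_ge alpha n z : 0 < alpha < 1 -> z <= 0 ->
  alpha * (- z) * (raisr (1 - alpha) n * expR z) <= `|fw alpha n.+1 z|.
Proof.
move=> a01 z0; have /andP[a0 a1] := a01.
have <- : (-1) ^+ n.+1 * fw alpha n.+1 z = `|fw alpha n.+1 z|.
  by rewrite -[LHS]ger0_norm ?fw_alternate// normrM normrX normrN1 expr1n mul1r.
rewrite signed_fwS ?(ltW a0) ?(ltW a1)//.
rewrite ler_wpM2l//; first by rewrite mulr_ge0 ?(ltW a0)// oppr_ge0.
rewrite big_nat_recr//= binn subnn fw0 expr0 !mul1r lerDr.
apply: sumr_ge0 => i _; rewrite mulr_ge0// mulr_ge0 ?fw_alternate//.
by rewrite raisr_ge0// subr_ge0 ltW.
Qed.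

End fox_wright_values.

(** * Binomial series and Taylor expansion *)

Section binomial_series.
Context {R : realType}.
Implicit Types (a b y z x rho alpha : R) (m n r : nat).

Let binc a m : R := fallr a m / m`!%:R.

Let cvg_binc_norm a rho : 0 <= rho < 1 ->
  cvgn (series (fun m => `|binc a m| * rho ^+ m)).
Proof.
move=> r01; have /andP[r0 _] := r01; pose A := (Num.truncn `|a|).+1.
apply: nondecreasing_is_cvgn.
  by apply: nondecreasing_series => m _ _; rewrite mulr_ge0 ?exprn_ge0.
exists ((1 - rho) ^- A) => _ [M _ <-].
apply: le_trans (sum_raisr_le A M r01); rewrite /series/=.
apply: ler_sum => m _; rewrite ler_wpM2r ?exprn_ge0//.
rewrite /binc normrM normfV [`|m`!%:R|]ger0_norm// ler_wpM2r ?invr_ge0//.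
by apply: normr_fallr_le; apply/ltW/Num.Theory.truncnS_gt.
Qed.

Let cvg_binc a y : `|y| < 1 -> cvgn (pseries (binc a) y).
Proof.
move=> y1; apply: (@cvg_series_dominated _ _ (fun m => `|binc a m| * `|y| ^+ m)).
  by move=> n; rewrite normrM normrX.
by apply: cvg_binc_norm; rewrite normr_ge0.
Qed.

Let S a y : R := limn (pseries (binc a) y).

Let pseries_diffs_binc a : pseries_diffs (binc a) = a *: binc (a - 1).
Proof.
apply/funext => i; rewrite /pseries_diffs /binc fallrSl factS natrM invfM.
have i0 : i.+1%:R != 0 :> R by rewrite pnatr_eq0.
by rewrite mulrCA !mulrA mulfK// fctE /GRing.scale/= mulrA.
Qed.

Let pseriesZ a (c : R^nat) y : pseries (a *: c) y = (fun n => a * pseries c y n).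
Proof.
apply/funext => n; rewrite /pseries/series/= mulr_sumr.
by apply: eq_bigr => i _; rewrite fctE /GRing.scale/= mulrA.
Qed.

Let limZ a b y : `|y| < 1 -> limn (pseries (a *: binc b) y) = a * S b y.
Proof.
move=> y1; apply/cvg_lim => //; rewrite pseriesZ; apply: cvgMl_tmp.
exact: cvg_binc.
Qed.

Let cvgZ a b y : `|y| < 1 -> cvgn (pseries (a *: binc b) y).
Proof.
move=> y1; apply/cvg_ex; exists (a * S b y); rewrite pseriesZ.
by apply: cvgMl_tmp; exact: cvg_binc.
Qed.

Let is_derive_S a y : `|y| < 1 -> is_derive y 1 (S a) (a * S (a - 1) y).
Proof.
move=> y1; pose K := (1 + `|y|) / 2.
have K0 : 0 <= K by rewrite divr_ge0// addr_ge0.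
have K1 : `|K| < 1 by rewrite ger0_norm// /K; lra.
rewrite -limZ// -pseries_diffs_binc.
apply: (@pseries_snd_diffs _ _ K).
- exact: cvg_binc.
- by rewrite pseries_diffs_binc; exact: cvgZ.
- rewrite pseries_diffs_binc.
  have -> : pseries_diffs (a *: binc (a - 1)) = a *: (pseries_diffs (binc (a - 1))).
    apply/funext => i; rewrite /pseries_diffs !fctE /GRing.scale/=; ring.
  by rewrite pseries_diffs_binc scalerA; exact: cvgZ.
- by rewrite [ltRHS]ger0_norm// /K; lra.
Qed.

Let S_pascal a y : `|y| < 1 -> S a y = (1 + y) * S (a - 1) y.
Proof.
move=> y1; have h : pseries (binc a) y n.+1 @[n --> \oo] --> S a y.
  by rewrite (cvg_shiftS (pseries (binc a) y)); exact: cvg_binc.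
rewrite -(cvg_lim _ h)//.
apply/cvg_lim => //.
have cs : pseries (binc (a - 1)) y N.+1 + y * pseries (binc (a - 1)) y N
    @[N --> \oo] --> S (a - 1) y + y * S (a - 1) y.
  apply: cvgD; last by apply: cvgMl_tmp; exact: cvg_binc.
  by rewrite (cvg_shiftS (pseries (binc (a - 1)) y)); exact: cvg_binc.
rewrite mulrDl mul1r; apply: cvg_trans cs; apply: near_eq_cvg.
apply: nearW => N; rewrite /pseries/series/= !big_nat_recl//= -addrA mulr_sumr.
rewrite -big_split/=; congr (_ + _); first by rewrite /binc !fallr0.
apply: eq_bigr => i _; rewrite /binc fallrS fallrSl factS natrM exprS.
have i0 : i.+1%:R != 0 :> R by rewrite pnatr_eq0.
have f0 : i`!%:R != 0 :> R by rewrite pnatr_eq0 -lt0n fact_gt0.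
rewrite -[i.+1%:R]natr1 in i0 *.
by field; rewrite f0 i0.
Qed.

Let S0 a : S a 0 = 1.
Proof.
apply/cvg_lim => //; rewrite /pseries -cvg_shiftS.
have -> : (fun n => [series binc a i * 0 ^+ i]_i n.+1) = cst 1.
  apply/funext => n; rewrite /series/= big_nat_recl//= big1 ?addr0.
    by rewrite /binc fallr0 fact0 divr1 mulr1.
  by move=> i _; rewrite expr0n mulr0.
exact: cvg_cst.
Qed.

(** The sum [S a] satisfies [(1 + y) * S' = a * S] by Pascal's rule, so that
    its quotient by [(1 + y) `^ a] has zero derivative on ]-1, 1[. *)
Lemma binomial_series a y : `|y| < 1 ->
  series (fun m => fallr a m / m`!%:R * y ^+ m) @ \oo --> (1 + y) `^ a.
Proof.
move=> y1; suff <- : S a y = (1 + y) `^ a by exact: cvg_binc.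
pose h x := S a x * (1 + x) `^ (- a).
have pos x : `|x| < 1 -> 0 < 1 + x by rewrite ltr_norml; lra.
have dh x : `|x| < 1 -> is_derive x 1 h 0.
  move=> x1; have px := pos x x1.
  have dp : is_derive x 1 (fun x => (1 + x) `^ (- a)) (- a * (1 + x) `^ (- a - 1)).
    have d1 : is_derive x 1 (fun x : R => 1 + x) 1.
      have := is_deriveD (is_derive_cst (1 : R) x (1 : R)) (is_derive_id x (1 : R)).
      by rewrite add0r.
    have := is_derive1_comp (is_derive1_powR (- a) px) d1.
    by rewrite mulr1.
  apply: (is_derive_eq (is_deriveM (is_derive_S a x1) dp)).
  rewrite /GRing.scale/= S_pascal//.
  have -> : (1 + x) `^ (- a) = (1 + x) * (1 + x) `^ (- a - 1).
    have -> : - a = 1 + (- a - 1) by ring.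
    by rewrite powRD ?(gt_eqF px) ?implybT// addrAC subrr add0r powRr1// ltW.
  by ring.
have ch x : `|x| < 1 -> {for x, continuous h}.
  move=> /dh[d _].
  by apply: differentiable_continuous; exact/derivable1_diffP.
have hc u v : `|u| < 1 -> `|v| < 1 -> u <= v -> h v = h u.
  move=> u1 v1 uv.
  have dhuv x : x \in `]u, v[ -> is_derive x 1 h (cst 0 x).
    rewrite in_itv/= => /andP[ux xv]; apply: dh.
    by move: u1 v1; rewrite !ltr_norml; lra.
  have chuv : {within `[u, v], continuous h}.
    apply: continuous_in_subspaceT => x; rewrite inE/= in_itv/= => /andP[ux xv].
    by apply: ch; move: u1 v1; rewrite !ltr_norml; lra.
  have [x _] := MVT_segment uv dhuv chuv.
  by rewrite mul0r => /eqP; rewrite subr_eq0 => /eqP.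
have hy : h y = h 0.
  have [y0|/ltW y0] := leP 0 y; first by apply: hc => //; rewrite normr0.
  by apply/esym/hc => //; rewrite normr0.
move: hy; rewrite /h S0 mul1r addr0 powR1 powRN.
by move=> /(canRL (mulfVK _)) ->; rewrite ?mul1r// gt_eqF// powR_gt0// pos.
Qed.

End binomial_series.

Section taylor.
Context {R : realType}.
Implicit Types (y z alpha : R) (j : nat).

(** Expanding each power by the binomial series and exchanging the two
    summations; the exchange is legitimate because the double series of absolute
    values is at most that of an exponential. *)
Lemma fw_taylor alpha j z y : 0 <= alpha <= 1 -> `|y| < 1 ->
  series (fun m => fw alpha (j + m) z * (y ^+ m / m`!%:R)) @ \oo -->
    (1 + y) ^- j * fw alpha j (z * (1 + y) `^ alpha).
Proof.
move=> a01 y1; have /andP[a0 a1] := a01.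
have py : 0 < 1 + y by move: y1; rewrite ltr_norml; lra.
pose f M r := \sum_(0 <= m < M)
  (fallr (alpha * r%:R) (j + m) * (z ^+ r / r`!%:R)) * (y ^+ m / m`!%:R).
pose s r := (1 + y) ^- j * (fallr (alpha * r%:R) j *
  ((z * (1 + y) `^ alpha) ^+ r / r`!%:R)).
(* [v] majorizes the inner sums: [`|fallr (alpha * r) (j + m)|] is at most
   [raisr r (j + m)], whose two factors [raisr r j] and [raisr (r + j) m] are
   bounded by powers of 2 and of [(1 - `|y|)^-1]. *)
pose q := 2 * `|z| * (1 - `|y|)^-1.
pose v r := j`!%:R * 2 ^+ j * (1 - `|y|) ^- j * (q ^+ r / r`!%:R).
have yy : 0 <= `|y| < 1 by rewrite normr_ge0.
have cv : cvgn (series v).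
  apply/cvg_ex; exists (j`!%:R * 2 ^+ j * (1 - `|y|) ^- j * expR q).
  by apply: cvg_series_scale; exact: cvg_series_exp_geom.
have fv M r : `|f M r| <= v r.
  apply: (le_trans (ler_norm_sum _ _ _)).
  apply: (@le_trans _ _ (\sum_(0 <= m < M) raisr r%:R j * (`|z| ^+ r / r`!%:R) *
      (raisr (r + j)%:R m / m`!%:R * `|y| ^+ m))).
    apply: ler_sum => m _; rewrite !normrM !normrX !normfV.
    rewrite [`|r`!%:R|]ger0_norm// [`|m`!%:R|]ger0_norm//.
    have -> : raisr r%:R j * (`|z| ^+ r / r`!%:R) *
      (raisr (r + j)%:R m / m`!%:R * `|y| ^+ m) = raisr r%:R (j + m) *
      (`|z| ^+ r / r`!%:R) * (`|y| ^+ m / m`!%:R).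
      by rewrite raisrD -natrD; ring.
    rewrite ler_wpM2r ?divr_ge0 ?exprn_ge0// ler_wpM2r ?divr_ge0 ?exprn_ge0//.
    by apply: normr_fallr_le; rewrite ger0_norm ?mulr_ge0// ler_piMl.
  rewrite -mulr_sumr /v.
  apply: (@le_trans _ _ (j`!%:R * 2 ^+ (r + j) * (`|z| ^+ r / r`!%:R) *
      (1 - `|y|) ^- (r + j))).
    apply: ler_pM; rewrite ?sum_raisr_le//.
    - by rewrite mulr_ge0 ?raisr_ge0// divr_ge0 ?exprn_ge0.
    - apply: sumr_ge0 => m _.
      by rewrite mulr_ge0 ?exprn_ge0// divr_ge0 ?raisr_ge0.
    - by rewrite ler_wpM2r ?divr_ge0 ?exprn_ge0// raisr_nat_le.
  rewrite /q !exprMn !exprD invfM exprVn le_eqVlt; apply/orP; left; apply/eqP.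
  by ring.
have fs r : f M r @[M --> \oo] --> s r.
  have bs := @binomial_series _ (alpha * r%:R - j%:R) y y1.
  have -> : s r = fallr (alpha * r%:R) j * (z ^+ r / r`!%:R) *
      (1 + y) `^ (alpha * r%:R - j%:R).
    rewrite /s powRB ?(gt_eqF py) ?implybT// powRrM !powR_mulrn ?powR_ge0 ?(ltW py)//.
    by rewrite exprMn; ring.
  apply: cvg_trans (cvg_series_scale bs); apply: near_eq_cvg; apply: nearW => M.
  rewrite /series/f/=; apply: eq_bigr => m _.
  by rewrite fallrD; ring.
have [cs cf] := tannery cv fv fs.
have -> : (1 + y) ^- j * fw alpha j (z * (1 + y) `^ alpha) = limn (series s).
  apply/esym/cvg_lim => //; apply: cvg_series_scale; exact: cvg_fw.
apply: cvg_trans cf; apply: near_eq_cvg; apply: nearW => M.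
apply/cvg_lim => //.
rewrite /series/=.
have cN : \sum_(0 <= m < M) series (fun r => fallr (alpha * r%:R) (j + m) *
    (z ^+ r / r`!%:R)) N * (y ^+ m / m`!%:R) @[N --> \oo] -->
    \sum_(0 <= m < M) fw alpha (j + m) z * (y ^+ m / m`!%:R).
  apply: cvg_big => [|m _]; first exact: add_continuous.
  by apply: cvgMr_tmp; exact: cvg_fw.
apply: cvg_trans cN; apply: near_eq_cvg; apply: nearW => N.
rewrite /f exchange_big/=; apply: eq_bigr => m _.
by rewrite /series/= mulr_suml.
Qed.

End taylor.

(** * The Taylor series inside and outside its disc of convergence *)

Section tsf_series.
Context {R : realType}.
Implicit Types (alpha lambda mu t z : R) (j k m n : nat).

Lemma tsf_termE alpha lambda mu t j m : 0 <= alpha ->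
  tsf_term alpha lambda mu t j m =
  fw alpha (j + m) (- (lambda `^ alpha) * t) * ((mu / lambda) ^+ m / m`!%:R).
Proof.
move=> a0; rewrite /tsf_term fox_wrightE// expr_div_n; ring.
Qed.

(** The general term is that of the Taylor series of [fw], with step
    [mu / lambda] relative to [lambda]. *)
Lemma cvg_tsf alpha lambda mu t j : 0 < lambda -> 0 < alpha < 1 ->
  0 < mu -> mu < lambda ->
  series (tsf_term alpha lambda mu t j) @ \oo -->
    (1 + mu / lambda) ^- j * fw alpha j (- ((lambda + mu) `^ alpha) * t).
Proof.
move=> l0 /andP[a0 a1] m0 ml.
have y1 : `|mu / lambda| < 1.
  by rewrite ger0_norm ?divr_ge0 ?(ltW l0) ?(ltW m0)// ltr_pdivrMr// mul1r.
have := @fw_taylor R alpha j (- (lambda `^ alpha) * t) _ _ y1.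
rewrite (ltW a0) (ltW a1) => /(_ isT).
have -> : - (lambda `^ alpha) * t * (1 + mu / lambda) `^ alpha =
    - ((lambda + mu) `^ alpha) * t.
  have -> : lambda + mu = lambda * (1 + mu / lambda).
    by rewrite mulrDr mulr1 mulrCA divff ?mulr1// gt_eqF.
  rewrite powRM ?(ltW l0)//; first by ring.
  by rewrite addr_ge0// divr_ge0 ?(ltW l0) ?(ltW m0).
by under eq_fun do rewrite -tsf_termE ?(ltW a0)//.
Qed.

Let fwS0 alpha n : 0 < alpha < 1 -> fw alpha n.+1 0 = 0.
Proof. by move=> /andP[a0 a1]; rewrite fwS ?(ltW a0) ?(ltW a1)// mulr0 mul0r. Qed.

Let cvg_tsf0 alpha lambda mu j : 0 < alpha < 1 ->
  series (tsf_term alpha lambda mu 0 j) @ \oo -->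
    (1 + mu / lambda) ^- j * fw alpha j (- ((lambda + mu) `^ alpha) * 0).
Proof.
move=> a01; have a0 : 0 <= alpha by case/andP: a01 => /ltW.
rewrite mulr0 -cvg_shiftS.
have -> : (fun n => series (tsf_term alpha lambda mu 0 j) n.+1) =
    cst (fw alpha j 0).
  apply/funext => n; rewrite /series/= big_nat_recl//= big1 ?addr0.
    by rewrite tsf_termE// mulr0 addn0 expr0 fact0 divr1 mulr1.
  by move=> i _; rewrite tsf_termE// mulr0 addnS fwS0// mul0r.
case: j => [|j]; first by rewrite expr0 invr1 mul1r; exact: cvg_cst.
by rewrite fwS0// mulr0; exact: cvg_cst.
Qed.

(** On and beyond the circle of convergence the [m]-th term is, in absolute
    value, at least a constant times [raisr (1 - alpha) (j + m).+1 / m`!], and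
    this ratio is at least [1 - alpha]. *)
Lemma not_cvg_tsf alpha lambda mu t j : 0 < lambda -> 0 < alpha < 1 ->
  0 < t -> lambda <= mu -> ~ cvgn (series (tsf_term alpha lambda mu t j.+2)).
Proof.
move=> l0 a01 t0 lm /cvg_series_cvg_0; have /andP[a0 a1] := a01.
set z := - (lambda `^ alpha) * t.
have z0 : z < 0 by rewrite /z mulNr oppr_lt0 mulr_gt0// powR_gt0.
pose C := alpha * (- z) * (1 - alpha) * expR z.
have C0 : 0 < C by rewrite /C !mulr_gt0 ?expR_gt0 ?oppr_gt0 ?subr_gt0.
have Cle m : C <= `|tsf_term alpha lambda mu t j.+2 m|.
  rewrite tsf_termE ?(ltW a0)// -/z !addSn normrM.
  have h1 : 1 <= `|(mu / lambda) ^+ m|.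
    rewrite normrX ger0_norm ?divr_ge0 ?(ltW l0) ?(le_trans (ltW l0))//.
    by rewrite exprn_ege1// ler_pdivlMr// mul1r.
  rewrite normrM normfV [`|m`!%:R|]ger0_norm// mulrCA.
  rewrite (le_trans _ (ler_peMl _ h1)) ?mulr_ge0 ?invr_ge0//.
  rewrite ler_pdivlMr ?ltr0n ?fact_gt0//.
  apply: le_trans (fw_alternateS_ge _ a01 (ltW z0)).
  have h2 : (1 - alpha) * m`!%:R <= raisr (1 - alpha) (j + m).+1.
    rewrite raisrSl ler_wpM2l ?subr_ge0 ?(ltW a1)//.
    apply: (@le_trans _ _ (j + m)`!%:R).
      by rewrite ler_nat; elim: j => // j IH;
        rewrite addSn factS (leq_trans IH)// leq_pmull.
    elim: (j + m)%N => [|i IH]; first by rewrite /raisr big_nil fact0.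
    rewrite factS natrM mulrC raisrS ler_pM// -natr1; lra.
  rewrite /C -!mulrA ler_wpM2l ?(ltW a0)// ler_wpM2l ?oppr_ge0 ?(ltW z0)//.
  by rewrite mulrCA [leRHS]mulrC ler_wpM2l ?expR_ge0.
move=> /cvgrPdist_lt/(_ _ C0)[N _ /(_ N (leqnn _))].
by rewrite /= sub0r normrN ltNge Cle.
Qed.

(** Convergence from some index on excludes [lambda <= mu], unless [t = 0], when
    each series has at most one nonzero term. *)
Lemma lim_tsf alpha lambda mu t k j : 0 < lambda -> 0 < alpha < 1 ->
  0 < mu -> 0 <= t ->
  (forall n, cvgn (series (tsf_term alpha lambda mu t (n + k)))) ->
  limn (series (tsf_term alpha lambda mu t j)) =
    (1 + mu / lambda) ^- j * fw alpha j (- ((lambda + mu) `^ alpha) * t).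
Proof.
move=> l0 a01 m0; rewrite le_eqVlt => /predU1P[<- _|t0 cA].
  by apply/cvg_lim => //; exact: cvg_tsf0.
have [ml|lm] := ltP mu lambda; first by apply/cvg_lim => //; exact: cvg_tsf.
by have /(not_cvg_tsf l0 a01 t0 lm) := cA 2%N.
Qed.

End tsf_series.

(** * Moments of a tempered stable variable *)

Section bounded_convergence.
Context d (T : measurableType d) (R : realType) (P : probability T R).
Implicit Types (f g : T -> R) (C : R).

Lemma integrable_bounded f C : measurable_fun setT f ->
  (forall w, `|f w| <= C) -> P.-integrable setT (EFin \o f).
Proof.
move=> mf fC; apply: (@le_integrable _ _ _ _ _ _ _ (cst C%:E)) => //.
- exact/measurable_EFinP.
- by move=> w _ /=; rewrite lee_fin (le_trans (fC w))// ler_norm.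
- exact: finite_measure_integrable_cst.
Qed.

Lemma cvg_Rintegral_bounded (f : nat -> T -> R) g C :
  (forall n, measurable_fun setT (f n)) -> (forall n w, `|f n w| <= C) ->
  (forall w, f n w @[n --> \oo] --> g w) ->
  \int[P]_w f n w @[n --> \oo] --> \int[P]_w g w.
Proof.
move=> mf fC fg.
have mg : measurable_fun setT g.
  by apply: (@measurable_fun_cvg _ _ _ _ f) => // w _; exact: fg.
have gC w : `|g w| <= C.
  have cl : `|f n w| @[n --> \oo] --> `|g w| by apply: cvg_norm; exact: fg.
  rewrite -(cvg_lim _ cl)//; apply: limr_le; first exact: (cvgP _ cl).
  exact: nearW.
apply: fine_cvg; rewrite /Rintegral fineK; last first.
  by apply: integrable_fin_num => //; exact: integrable_bounded gC.
apply: (@dominated_cvg _ _ _ P setT _ (fun n w => (f n w)%:E) _ (cst C%:E)) => //.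
- by move=> n; exact/measurable_EFinP.
- by move=> w _; apply: cvg_EFin; [exact: nearW|exact: fg].
- exact: finite_measure_integrable_cst.
- by move=> n w _; rewrite lee_fin.
Qed.

End bounded_convergence.

Section laplace_moments.
Context d (T : measurableType d) (R : realType) (P : probability T R).
Variable X : T -> R.
Hypotheses (mX : measurable_fun setT X) (X0 : forall w, 0 <= X w).
Implicit Types (lambda h alpha mu t : R) (j m : nat).

Lemma sum_exp_le (x : R) M : 0 <= x ->
  \sum_(0 <= m < M) x ^+ m / m`!%:R <= expR x.
Proof.
move=> x0; have cx := @cvg_series_exp_geom _ x; rewrite -(cvg_lim _ cx)//.
apply: (nondecreasing_cvgn_le _ (cvgP _ cx) M).
by apply: nondecreasing_series => m _ _; rewrite divr_ge0 ?exprn_ge0.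
Qed.

Let emom lambda m w : R := X w ^+ m * expR (- (lambda * X w)).

Let measurable_emom lambda m : measurable_fun setT (emom lambda m).
Proof.
apply: measurable_funM; first exact: measurable_funX.
by apply: measurableT_comp => //; apply: measurableT_comp => //;
  exact: measurable_funM.
Qed.

Let emom_le lambda m w : 0 < lambda -> `|emom lambda m w| <= m`!%:R / lambda ^+ m.
Proof.
move=> l0; rewrite ger0_norm ?mulr_ge0 ?exprn_ge0 ?expR_ge0//.
rewrite /emom expRN ler_pdivrMr ?expR_gt0// mulrAC ler_pdivlMr ?exprn_gt0//.
rewrite -exprMn [X w * _]mulrC -ler_pdivrMl ?ltr0n ?fact_gt0// [leLHS]mulrC.
have lX : 0 <= lambda * X w by rewrite mulr_ge0 ?(ltW l0).
apply: le_trans (sum_exp_le m.+1 lX); rewrite big_nat_recr//= lerDr.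
by apply: sumr_ge0 => i _; rewrite divr_ge0 ?exprn_ge0.
Qed.

Let integrable_emom lambda m : 0 < lambda -> P.-integrable setT (EFin \o emom lambda m).
Proof.
by move=> l0; apply: integrable_bounded => // w; exact: emom_le.
Qed.

(** Expanding [expR (- h * X)]: the partial sums multiplied by
    [expR (- lambda * X)] are bounded by [expR ((h - lambda) * X)], hence by 1. *)
Lemma cvg_laplace_moments lambda h : 0 < lambda -> 0 <= h <= lambda ->
  series (fun m => (\int[P]_w (X w ^+ m * expR (- (lambda * X w)))) *
    ((- h) ^+ m / m`!%:R)) @ \oo --> \int[P]_w expR (- ((lambda + h) * X w)).
Proof.
move=> l0 /andP[h0 hl].
pose f M w := \sum_(0 <= m < M) emom lambda m w * ((- h) ^+ m / m`!%:R).
have mf M : measurable_fun setT (f M).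
  apply: measurable_sum => m.
  by apply: measurable_funM => //; exact: measurable_emom.
have f1 M w : `|f M w| <= 1.
  have hX : 0 <= h * X w by rewrite mulr_ge0.
  apply: (@le_trans _ _ (expR (- (lambda * X w)) *
      \sum_(0 <= m < M) (h * X w) ^+ m / m`!%:R)).
    rewrite mulr_sumr (le_trans (ler_norm_sum _ _ _))//.
    apply: ler_sum => m _; rewrite /emom !normrM !normrX normrN normfV.
    rewrite (ger0_norm (X0 w)) (ger0_norm (expR_ge0 _)) (ger0_norm h0).
    by rewrite ger0_norm// exprMn le_eqVlt; apply/orP; left; apply/eqP; ring.
  apply: (@le_trans _ _ (expR (- (lambda * X w)) * expR (h * X w))).
    by rewrite ler_wpM2l ?expR_ge0// sum_exp_le.
  rewrite -expRD -[leRHS]expR0 ler_expR addrC -mulrBl.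
  by rewrite mulr_le0_ge0// subr_le0.
have ff w : f M w @[M --> \oo] --> expR (- ((lambda + h) * X w)).
  rewrite mulrDl opprD expRD -(mulNr h).
  have ce := cvg_series_scale (c := expR (- (lambda * X w)))
    (@cvg_series_exp_geom _ (- h * X w)).
  apply: cvg_trans ce.
  apply: near_eq_cvg; apply: nearW => M; apply: eq_bigr => m _.
  by rewrite /emom exprMn; ring.
have cR : \int[P]_w f M w @[M --> \oo] --> \int[P]_w expR (- ((lambda + h) * X w)).
  exact: cvg_Rintegral_bounded mf f1 ff.
apply: cvg_trans cR.
apply: near_eq_cvg; apply: nearW => M; rewrite /series/= /f.
have int_c c m : P.-integrable setT (EFin \o (fun w => emom lambda m w * c)).
  by apply: (@integrable_bounded _ _ _ P _ (m`!%:R / lambda ^+ m * `|c|)) => [|w];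
    [exact: measurable_funM|rewrite normrM ler_wpM2r// emom_le].
elim: M => [|M IH].
  rewrite big_nil; under eq_Rintegral do rewrite big_nil.
  by rewrite Rintegral_cst// mul0r.
rewrite big_nat_recr//= -IH -/(emom lambda M) -RintegralZr//; last exact: integrable_emom.
rewrite -RintegralD//;
  [|exact: (@integrable_bounded _ _ _ P (f M) 1 (mf M) (f1 M))|exact: int_c].
by apply: eq_Rintegral => w _; rewrite big_nat_recr.
Qed.

(** The Laplace transform at [lambda + h] has two power series expansions in
    [h]: one has the moments as coefficients, the other, by the Taylor expansion
    about [lambda + mu], the values of [fw]. Equating coefficients replaces
    differentiation under the expectation. *)
Lemma tempered_moment alpha mu t lambda j : 0 < alpha < 1 -> 0 < mu ->
  0 < lambda ->
  (forall s, 0 <= s -> ('E_P[fun w => expR (- s * X w)] =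
      (expR (- t * ((s + mu) `^ alpha - mu `^ alpha)))%:E)%E) ->
  \int[P]_w (X w ^+ j * expR (- (lambda * X w))) =
    (-1) ^+ j * expR (t * mu `^ alpha) * (lambda + mu) ^- j *
    fw alpha j (- ((lambda + mu) `^ alpha) * t).
Proof.
move=> /andP[a0 a1] m0 l0 laplace.
pose x := lambda + mu; have x0 : 0 < x by rewrite addr_gt0.
pose z := - (x `^ alpha) * t.
pose M m := \int[P]_w (X w ^+ m * expR (- (lambda * X w))).
pose K := expR (t * mu `^ alpha).
pose c m := M m * ((-1) ^+ m / m`!%:R) - K * (fw alpha m z * (x ^- m / m`!%:R)).
have c0 : forall m, c m = 0.
  apply: (power_series_eq0 l0) => h /andP[h0 hl].
  have lap : \int[P]_w expR (- ((lambda + h) * X w)) = K * expR (- ((x + h) `^ alpha * t)).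
    have := laplace (lambda + h); rewrite unlock => /(_ _)/(congr1 fine)/= L.
    rewrite /Rintegral; under eq_integral do rewrite -mulNr.
    rewrite L ?addr_ge0 ?(ltW l0) ?(ltW h0)// -expRD /x.
    by congr expR; rewrite [lambda + h + mu]addrAC; ring.
  have s1 : series (fun m => M m * ((- h) ^+ m / m`!%:R)) @ \oo -->
      K * expR (- ((x + h) `^ alpha * t)).
    by rewrite -lap; apply: cvg_laplace_moments => //; rewrite !ltW.
  have y1 : `|h / x| < 1.
    rewrite ger0_norm ?divr_ge0 ?(ltW h0) ?(ltW x0)// ltr_pdivrMr// mul1r /x.
    lra.
  have s2 : series (fun m => K * (fw alpha m z * ((h / x) ^+ m / m`!%:R))) @ \oo -->
      K * expR (- ((x + h) `^ alpha * t)).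
    apply: cvg_series_scale.
    have := @fw_taylor R alpha 0 z _ _ y1; rewrite (ltW a0) (ltW a1) => /(_ isT).
    rewrite expr0 invr1 mul1r fw0.
    suff -> : z * (1 + h / x) `^ alpha = - ((x + h) `^ alpha * t) by [].
    have -> : x + h = x * (1 + h / x).
      by rewrite mulrDr mulr1 mulrCA divff ?mulr1// gt_eqF.
    rewrite powRM ?(ltW x0)//; first by rewrite /z; ring.
    by rewrite addr_ge0// divr_ge0 ?(ltW h0) ?(ltW x0).
  have s12 : series (fun m => M m * ((- h) ^+ m / m`!%:R)) n -
      series (fun m => K * (fw alpha m z * ((h / x) ^+ m / m`!%:R))) n
      @[n --> \oo] --> (0 : R).
    by rewrite -(subrr (K * expR (- ((x + h) `^ alpha * t)))); exact: cvgB.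
  apply: cvg_trans s12; apply: near_eq_cvg; apply: nearW => n.
  rewrite /series/= -sumrB; apply: eq_bigr => m _.
  by rewrite /c [(- h) ^+ m]exprNn expr_div_n; ring.
have := c0 j; rewrite /c => /subr0_eq; rewrite -/(M j) -/x -/z -/K => E.
have f0 : j`!%:R != 0 :> R by rewrite pnatr_eq0 -lt0n fact_gt0.
have s0 : (-1) ^+ j * (-1) ^+ j = 1 :> R by rewrite -exprMn mulrNN mulr1 expr1n.
have -> : M j = M j * ((-1) ^+ j / j`!%:R) * ((-1) ^+ j * j`!%:R).
  rewrite -[LHS]mulr1 -[X in _ * X = _]s0; field; exact: f0.
by rewrite E; field; rewrite f0 expf_neq0// gt_eqF.
Qed.

(** In terms of the Poisson weights the powers of [lambda + mu] and of [lambda]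
    combine into the factor that also appears in the sum of the series
    [tsf_term]. *)
Lemma tempered_poisson_weight alpha mu t lambda j : 0 < alpha < 1 -> 0 < mu ->
  0 < lambda ->
  (forall s, 0 <= s -> ('E_P[fun w => expR (- s * X w)] =
      (expR (- t * ((s + mu) `^ alpha - mu `^ alpha)))%:E)%E) ->
  \int[P]_w ((lambda * X w) ^+ j / j`!%:R * expR (- (lambda * X w))) =
    (-1) ^+ j / j`!%:R * expR (t * mu `^ alpha) *
    ((1 + mu / lambda) ^- j * fw alpha j (- ((lambda + mu) `^ alpha) * t)).
Proof.
move=> a01 m0 l0 laplace.
under eq_Rintegral => w _.
  have -> : (lambda * X w) ^+ j / j`!%:R * expR (- (lambda * X w)) =
    lambda ^+ j / j`!%:R * (X w ^+ j * expR (- (lambda * X w))).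
    by rewrite exprMn; ring.
  over.
rewrite RintegralZl//; last exact: integrable_emom.
rewrite (tempered_moment _ a01 m0 l0 laplace).
have -> : lambda + mu = lambda * (1 + mu / lambda).
  by rewrite mulrDr mulr1 mulrCA divff ?mulr1// gt_eqF.
rewrite exprMn; field.
rewrite pnatr_eq0 -lt0n fact_gt0/= !expf_neq0 ?gt_eqF//.
by rewrite addr_gt0// divr_gt0.
Qed.

End laplace_moments.

(** * Integer variables at independent discrete times *)

Section discrete_variables.
Context d (T : measurableType d) (R : realType) (P : probability T R).
Implicit Types (c : T -> nat) (v : nat -> R) (A : set T).

Lemma measure_partition c A : measurable A ->
  (forall p, measurable (c @^-1` [set p])) ->
  P A = (\sum_(p <oo) P (A `&` c @^-1` [set p]))%E.
Proof.
move=> mA mc; have E : A = \bigcup_p (A `&` c @^-1` [set p]).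
  apply/seteqP; split=> [w Aw|w [p _ []]//].
  by exists (c w).
rewrite {1}E measure_semi_bigcup//.
- by move=> p; exact: measurableI.
- exact: trivIset_preimage1_in.
- by rewrite -E.
Qed.

Lemma measurable_discrete c v : (forall p, measurable (c @^-1` [set p])) ->
  measurable_fun [set: T] (fun w => v (c w)).
Proof.
move=> mc _ Y mY; rewrite setTI.
have -> : (fun w => v (c w)) @^-1` Y =
    \bigcup_(p in [set p | Y (v p)]) (c @^-1` [set p]).
  apply/seteqP; split=> [w Yw|w [p Yp cw]]; first by exists (c w).
  by rewrite /= (cw : c w = p).
exact: bigcup_measurable.
Qed.

Lemma integral_discrete c v : (forall p, measurable (c @^-1` [set p])) ->
  (forall p, 0 <= v p) ->
  (\int[P]_w (v (c w))%:E = \sum_(p <oo) (v p)%:E * P (c @^-1` [set p]))%E.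
Proof.
move=> mc v0; have E : [set: T] = \bigcup_p (c @^-1` [set p]).
  by apply/seteqP; split=> // w _; exists (c w).
have mv := measurable_discrete v mc.
rewrite E ge0_integral_bigcup//.
- apply: eq_eseriesr => p _; rewrite -integral_cst//.
  by apply: eq_integral => w; rewrite inE => cw; rewrite -(cw : c w = p).
- by rewrite -E; exact/measurable_EFinP.
- by move=> w _; rewrite lee_fin.
- exact: trivIset_preimage1.
Qed.

(** The joint law of two integer variables sampled at independent random integer
    times: for fixed values of the times the probability is a product, and
    so is the double sum over these values. *)
Lemma indep_sampling (A1 A2 : nat -> set T) (c1 c2 : T -> nat) (v1 v2 : nat -> R) :
  (forall p, measurable (A1 p)) -> (forall p, measurable (A2 p)) ->
  (forall p, measurable (c1 @^-1` [set p])) ->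
  (forall p, measurable (c2 @^-1` [set p])) ->
  (forall p, 0 <= v1 p <= 1) -> (forall p, 0 <= v2 p <= 1) ->
  (forall p q, P (A1 p `&` (A2 q `&` (c1 @^-1` [set p] `&` c2 @^-1` [set q]))) =
    ((v1 p)%:E * ((v2 q)%:E * (P (c1 @^-1` [set p]) * P (c2 @^-1` [set q]))))%E) ->
  measurable [set w | A1 (c1 w) w /\ A2 (c2 w) w] /\
  fine (P [set w | A1 (c1 w) w /\ A2 (c2 w) w]) =
    (\int[P]_w v1 (c1 w)) * (\int[P]_w v2 (c2 w)).
Proof.
move=> mA1 mA2 mc1 mc2 v1b v2b ind.
set F := [set w | _].
have EF p q : F `&` c1 @^-1` [set p] `&` c2 @^-1` [set q] =
    A1 p `&` (A2 q `&` (c1 @^-1` [set p] `&` c2 @^-1` [set q])).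
  apply/seteqP; split=> w /=.
    by move=> [[[a1 a2] <-] <-].
  by move=> [+ [+ [c1w c2w]]]; rewrite -c1w -c2w; split.
have mF : measurable F.
  have -> : F = \bigcup_p \bigcup_q
      (A1 p `&` (A2 q `&` (c1 @^-1` [set p] `&` c2 @^-1` [set q]))).
    apply/seteqP; split=> w; last by move=> [p _ [q _]]; rewrite -EF => -[[]].
    by move=> [a1 a2]; exists (c1 w) => //; exists (c2 w).
  apply: bigcupT_measurable => p; apply: bigcupT_measurable => q.
  by do! apply: measurableI.
split=> //.
have v10 p : 0 <= v1 p by case/andP: (v1b p).
have v20 p : 0 <= v2 p by case/andP: (v2b p).
have fin c v : (forall p, measurable (c @^-1` [set p])) -> (forall p, 0 <= v p <= 1) ->
    (\int[P]_w (v (c w))%:E)%E \is a fin_num.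
  move=> mc vb; apply: integrable_fin_num => //.
  apply: (@integrable_bounded _ _ _ P (fun w => v (c w)) 1).
    exact: measurable_discrete.
  by move=> w; have /andP[h0 h1] := vb (c w); rewrite ger0_norm.
rewrite /Rintegral -fineM ?fin//; congr fine.
rewrite (measure_partition mF mc1) !integral_discrete//.
have S2f : (\sum_(q <oo) (v2 q)%:E * P (c2 @^-1` [set q]))%E \is a fin_num.
  by rewrite -integral_discrete// fin.
rewrite -(fineK S2f) muleC -nneseriesZl; last first.
  by move=> p _; rewrite mule_ge0// lee_fin.
apply: eq_eseriesr => p _.
rewrite (measure_partition _ mc2); last exact: measurableI.
rewrite (fineK S2f) muleC.
have Pf : ((v1 p)%:E * P (c1 @^-1` [set p]) =
    (v1 p * fine (P (c1 @^-1` [set p])))%R%:E)%E.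
  by rewrite EFinM fineK// fin_num_measure.
rewrite Pf -nneseriesZl; last by move=> q _; rewrite mule_ge0// lee_fin.
apply: eq_eseriesr => q _; rewrite -Pf EF ind.
by rewrite -!muleA; congr (_ * _)%E; rewrite muleCA.
Qed.

End discrete_variables.

Section poisson_weight.
Context {R : realType}.
Implicit Types (x : R) (a : nat).

(** The Poisson weight continued to rate 0, where [poisson_pmf] jumps to 1. *)
Definition poisson_weight a x : R := x ^+ a / a`!%:R * expR (- x).

Lemma poisson_pmf_weight (x : R) a : 0 < x -> poisson_pmf x a = poisson_weight a x.
Proof. by rewrite /poisson_pmf => ->. Qed.

Lemma poisson_weight_ge0 a x : 0 <= x -> 0 <= poisson_weight a x.
Proof. by move=> x0; rewrite mulr_ge0 ?expR_ge0// divr_ge0 ?exprn_ge0. Qed.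

Lemma poisson_weight_le1 a x : 0 <= x -> poisson_weight a x <= 1.
Proof.
move=> x0; rewrite /poisson_weight expRN ler_pdivrMr ?expR_gt0// mul1r.
apply: le_trans (sum_exp_le a.+1 x0); rewrite big_nat_recr//= lerDr.
by apply: sumr_ge0 => i _; rewrite divr_ge0 ?exprn_ge0.
Qed.

Lemma continuous_poisson_weight a : continuous (poisson_weight a).
Proof.
move=> x; apply: cvgM.
  by apply: cvgM; [exact: exprn_continuous|exact: cvg_cst].
by apply: continuous_comp; [exact: continuousN|exact: continuous_expR].
Qed.

End poisson_weight.

Section grid.
Context {R : realType}.
Implicit Types (x : R) (n p : nat).

(** Times are rounded up to the next multiple of [n.+1%:R^-1], strictly beyond
    the time itself: the rounded times are positive, where the counts have a
    Poisson law, and approach the time from the right, where the paths are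
    continuous. *)
Definition cell n x : nat := Num.truncn (x * n.+1%:R).
Definition gridpt n p : R := p.+1%:R / n.+1%:R.

Lemma gridpt_gt0 n p : 0 < gridpt n p.
Proof. by rewrite divr_gt0. Qed.

Lemma gridpt_gt n x : x < gridpt n (cell n x).
Proof. by rewrite ltr_pdivlMr// Num.Theory.truncnS_gt. Qed.

Lemma gridpt_le n x : 0 <= x -> gridpt n (cell n x) <= x + n.+1%:R^-1.
Proof.
move=> x0; rewrite /gridpt -natr1 mulrDl mul1r lerD2r ler_pdivrMr//.
by rewrite Num.Theory.truncn_le mulr_ge0.
Qed.

Lemma cvg_gridpt x : 0 <= x -> gridpt n (cell n x) @[n --> \oo] --> x.
Proof.
move=> x0; apply: (@squeeze_cvgr _ _ _ _ (cst x) (fun n => x + n.+1%:R^-1)).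
- by apply: nearW => n; rewrite (ltW (gridpt_gt _ _))/= gridpt_le.
- exact: cvg_cst.
- rewrite -[X in _ --> X]addr0; apply: cvgD; first exact: cvg_cst.
  exact: cvg_harmonic.
Qed.

Lemma cellE n p x : 0 <= x ->
  (cell n x == p) = (x \in `[p%:R / n.+1%:R, p.+1%:R / n.+1%:R[).
Proof.
move=> x0; rewrite /cell Num.Theory.truncn_eq ?mulr_ge0// in_itv/=.
by rewrite ler_pdivrMr// ltr_pdivlMr.
Qed.

End grid.

(** * Poisson processes at subordinated times *)

Section subordinated_counts.
Context d (T : measurableType d) (R : realType) (P : probability T R).
Implicit Types (A : set T) (N : R -> T -> nat) (D X : R -> T -> R).

Lemma independent_processes4_events X1 X2 X3 X4 A1 A2 A3 A4 :
  independent_processes4 P X1 X2 X3 X4 ->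
  sigma_process X1 A1 -> sigma_process X2 A2 ->
  sigma_process X3 A3 -> sigma_process X4 A4 ->
  (P (A1 `&` (A2 `&` (A3 `&` A4))) = P A1 * (P A2 * (P A3 * P A4)))%E.
Proof.
move=> ind h1 h2 h3 h4.
pose A (i : 'I_4) := nth set0 [:: A1; A2; A3; A4] i.
have := ind [set: 'I_4]%SET A.
rewrite (eq_bigl xpredT) => [|i]; last by rewrite inE.
rewrite !big_ord_recl big_ord0 /A/= mule1 => <-.
  congr (P _); apply/seteqP; split=> w.
    by move=> [a1 [a2 [a3 a4]]] [[|[|[|[|//]]]] ?] _.
  move=> h; split; [|split; [|split]].
  - by apply: (h ord0); rewrite /= inE.
  - by apply: (h (lift ord0 ord0)); rewrite /= inE.
  - by apply: (h (lift ord0 (lift ord0 ord0))); rewrite /= inE.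
  - by apply: (h (lift ord0 (lift ord0 (lift ord0 ord0)))); rewrite /= inE.
by move=> [[|[|[|[|//]]]] ?] _.
Qed.

Lemma sigma_process_preimage X s (B : set R) : 0 <= s -> measurable B ->
  sigma_process X (X s @^-1` B).
Proof.
move=> s0 mB; apply: sub_sigma_algebra; exists s => //=.
by exists B => //; rewrite setTI.
Qed.

Lemma count_eventE N s a :
  [set w | N s w = a] = real_process N s @^-1` [set a%:R].
Proof.
apply/seteqP; split=> w /=; rewrite /real_process; first by move->.
by move/eqP; rewrite eqr_nat => /eqP.
Qed.

Lemma poisson_process_law lambda N s a : poisson_process P lambda N ->
  0 < lambda -> 0 < s -> (P [set w | N s w = a] = (poisson_weight a (lambda * s))%:E)%E.
Proof.
move=> hN l0 s0; rewrite -poisson_pmf_weight ?mulr_gt0//.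
have := pp_law hN a (lexx 0) s0; rewrite subr0 => <-; congr (P _).
apply/seteqP; split=> w /=; have := mp_start (pp_process hN) w.
  by rewrite /real_process => /eqP; rewrite pnatr_eq0 => /eqP ->.
by rewrite /real_process => /eqP; rewrite pnatr_eq0 => /eqP ->.
Qed.

Lemma measurable_count lambda N s a : poisson_process P lambda N -> 0 <= s ->
  measurable [set w | N s w = a].
Proof.
move=> hN s0; rewrite count_eventE -[X in measurable X]setTI.
by apply: (mp_measurable (pp_process hN)).
Qed.

Lemma subordinator_ge0 alpha mu D t w : tempered_stable_subordinator P alpha mu D ->
  0 <= t -> 0 <= D t w.
Proof.
move=> /tss_subordinator/sub_process hD t0.
by rewrite -(mp_start hD w) (mp_nondecreasing hD).
Qed.

Lemma subordinator_measurable alpha mu D t :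
  tempered_stable_subordinator P alpha mu D -> 0 <= t ->
  measurable_fun setT (D t).
Proof.
by move=> /tss_subordinator/sub_process hD t0; exact: (mp_measurable hD).
Qed.

Lemma cell_eventE D t n p : (forall w, 0 <= D t w) ->
  (fun w => cell n (D t w)) @^-1` [set p] =
  D t @^-1` `[p%:R / n.+1%:R, p.+1%:R / n.+1%:R[.
Proof.
move=> D0; apply/seteqP; split=> w /=; first by move=> h; rewrite -cellE// h.
by rewrite -cellE// => /eqP.
Qed.

Lemma cvgn_nat_near (u : nat -> nat) (l : nat) :
  (u n)%:R @[n --> \oo] --> (l%:R : R) -> \forall n \near \oo, u n = l.
Proof.
move=> /cvgrPdist_lt/(_ 1 ltr01); apply: filterS => n /=.
rewrite -[l%:R]/(l%:Z%:~R) -[(u n)%:R]/((u n)%:Z%:~R) -intrB -intr_norm.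
rewrite (_ : 1 = 1%:~R)// ltr_int => h.
have /eqP : `|l%:Z - (u n)%:Z| == 0 by rewrite eq_le normr_ge0 andbT -ltzD1.
by move/eqP; rewrite normr_eq0 subr_eq0 => /eqP[].
Qed.

Lemma count_gridpt_near lambda N x w : poisson_process P lambda N -> 0 <= x ->
  \forall n \near \oo, N (gridpt n (cell n x)) w = N x w.
Proof.
move=> hN x0; apply: cvgn_nat_near.
have /cvg_at_rightP := mp_right_continuous (pp_process hN) (w := w) x0.
by apply; split; [move=> n; exact: gridpt_gt|exact: cvg_gridpt].
Qed.

Variables (lambda1 lambda2 alpha1 alpha2 mu1 mu2 : R).
Variables (N1 N2 : R -> T -> nat) (D1 D2 : R -> T -> R).
Hypotheses (hlambda1 : 0 < lambda1) (hlambda2 : 0 < lambda2).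
Hypotheses (hN1 : poisson_process P lambda1 N1) (hN2 : poisson_process P lambda2 N2).
Hypothesis hD1 : tempered_stable_subordinator P alpha1 mu1 D1.
Hypothesis hD2 : tempered_stable_subordinator P alpha2 mu2 D2.
Hypothesis hind :
  independent_processes4 P (real_process N1) (real_process N2) D1 D2.
Variables (t : R) (ht : 0 <= t).

Let D1_ge0 w : 0 <= D1 t w. Proof. exact: subordinator_ge0 hD1 ht. Qed.
Let D2_ge0 w : 0 <= D2 t w. Proof. exact: subordinator_ge0 hD2 ht. Qed.

(** At the grid points the clocks take countably many values, and independence
    can be applied value by value; as the mesh tends to 0, right continuity of
    the Poisson paths gives the law at the clocks themselves. *)
Lemma joint_count_law a b :
  measurable [set w | N1 (D1 t w) w = a /\ N2 (D2 t w) w = b] /\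
  fine (P [set w | N1 (D1 t w) w = a /\ N2 (D2 t w) w = b]) =
    (\int[P]_w poisson_weight a (lambda1 * D1 t w)) *
    (\int[P]_w poisson_weight b (lambda2 * D2 t w)).
Proof.
pose c1 n w := cell n (D1 t w); pose c2 n w := cell n (D2 t w).
pose F n := [set w | N1 (gridpt n (c1 n w)) w = a /\ N2 (gridpt n (c2 n w)) w = b].
set E := [set w | _].
have mc1 n p : measurable (c1 n @^-1` [set p]).
  rewrite cell_eventE// -[X in measurable X]setTI.
  by apply: (subordinator_measurable hD1 ht) => //; exact: measurable_itv.
have mc2 n p : measurable (c2 n @^-1` [set p]).
  rewrite cell_eventE// -[X in measurable X]setTI.
  by apply: (subordinator_measurable hD2 ht) => //; exact: measurable_itv.
have weight01 c (lambda : R) n p : 0 < lambda ->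
    0 <= poisson_weight c (lambda * gridpt n p) <= 1.
  move=> l0; have g0 := gridpt_gt0 (R := R) n p.
  have x0 : 0 <= lambda * gridpt n p by rewrite mulr_ge0 ?(ltW l0) ?(ltW g0).
  by rewrite poisson_weight_ge0 ?poisson_weight_le1.
have FP n := @indep_sampling _ _ _ P (fun p => [set w | N1 (gridpt n p) w = a])
  (fun p => [set w | N2 (gridpt n p) w = b]) (c1 n) (c2 n)
  (fun p => poisson_weight a (lambda1 * gridpt n p))
  (fun p => poisson_weight b (lambda2 * gridpt n p))
  (fun p => measurable_count a hN1 (ltW (gridpt_gt0 n p)))
  (fun p => measurable_count b hN2 (ltW (gridpt_gt0 n p)))
  (mc1 n) (mc2 n)
  (fun p => weight01 a lambda1 n p hlambda1) (fun p => weight01 b lambda2 n p hlambda2).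
have {FP} FP n : measurable (F n) /\ fine (P (F n)) =
    (\int[P]_w poisson_weight a (lambda1 * gridpt n (c1 n w))) *
    (\int[P]_w poisson_weight b (lambda2 * gridpt n (c2 n w))).
  apply: FP => p q.
  rewrite (independent_processes4_events hind).
  - by rewrite (poisson_process_law a hN1)// ?gridpt_gt0//
       (poisson_process_law b hN2)// gridpt_gt0.
  - rewrite count_eventE; apply: sigma_process_preimage => //.
    exact/ltW/gridpt_gt0.
  - rewrite count_eventE; apply: sigma_process_preimage => //.
    exact/ltW/gridpt_gt0.
  - by rewrite cell_eventE//; apply: sigma_process_preimage.
  - by rewrite cell_eventE//; apply: sigma_process_preimage.
have mF n : measurable (F n) by have [] := FP n.
have FE w : \1_(F n) w @[n --> \oo] --> (\1_E w : R).
  apply: cvg_near_cst.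
  near=> n.
  have n1 : N1 (gridpt n (c1 n w)) w = N1 (D1 t w) w.
    by near: n; exact: (count_gridpt_near w hN1 (D1_ge0 w)).
  have n2 : N2 (gridpt n (c2 n w)) w = N2 (D2 t w) w.
    by near: n; exact: (count_gridpt_near w hN2 (D2_ge0 w)).
  rewrite !indicE; congr ((_ : bool)%:R); apply/idP/idP;
    by rewrite !inE /F /E /= n1 n2.
have m1F n : measurable_fun setT (\1_(F n) : T -> R) by exact: measurable_indic.
have mE : measurable E.
  apply/(measurable_indicP R).
  by apply: (@measurable_fun_cvg _ _ _ _ (fun n => \1_(F n))) => // w _; exact: FE.
split=> //.
have intE (G : set T) : measurable G -> fine (P G) = \int[P]_w \1_G w.
  by move=> mG; rewrite /Rintegral integral_indic// setIT.
have cE : fine (P (F n)) @[n --> \oo] --> fine (P E).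
  rewrite intE//; under eq_cvg do rewrite intE//.
  apply: (@cvg_Rintegral_bounded _ _ _ _ _ _ 1) => // n w.
  by rewrite indicE; case: (_ \in _); rewrite ?normr1 ?normr0.
have cp lambda c (D : R -> T -> R) : 0 < lambda -> (forall w, 0 <= D t w) ->
    (forall n p, measurable ((fun w => cell n (D t w)) @^-1` [set p])) ->
    \int[P]_w poisson_weight c (lambda * gridpt n (cell n (D t w))) @[n --> \oo] -->
    \int[P]_w poisson_weight c (lambda * D t w).
  move=> l0 D0 mD; apply: (@cvg_Rintegral_bounded _ _ _ _ _ _ 1).
  - by move=> n; apply: (measurable_discrete (fun p => poisson_weight c (lambda * gridpt n p))).
  - move=> n w; have /andP[h0 h1] := weight01 c lambda n (cell n (D t w)) l0.
    by rewrite ger0_norm.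
  - move=> w; apply: continuous_cvg; first exact: continuous_poisson_weight.
    by apply: cvgMl_tmp; exact: cvg_gridpt.
have cFP : fine (P (F n)) @[n --> \oo] -->
    (\int[P]_w poisson_weight a (lambda1 * D1 t w)) *
    (\int[P]_w poisson_weight b (lambda2 * D2 t w)).
  have -> : (fun n => fine (P (F n))) = (fun n =>
      (\int[P]_w poisson_weight a (lambda1 * gridpt n (c1 n w))) *
      (\int[P]_w poisson_weight b (lambda2 * gridpt n (c2 n w)))).
    by apply/funext => n; have [_ ->] := FP n.
  by apply: cvgM; exact: cp.
exact: (cvg_unique _ cE cFP).
Unshelve. all: by end_near. Qed.

End subordinated_counts.

Lemma cvg_series_measure_bigcup d (T : measurableType d) (R : realType)
    (P : probability T R) (F : nat -> set T) :
  (forall n, measurable (F n)) -> trivIset setT F ->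
  series (fun n => fine (P (F n))) @ \oo --> fine (P (\bigcup_n F n)).
Proof.
move=> mF tF; have mU : measurable (\bigcup_n F n) by exact: bigcupT_measurable.
have h := @measure_semi_sigma_additive _ _ _ P F mF tF mU.
have hf : fine (\sum_(0 <= i < n) P (F i))%E @[n --> \oo] -->
    fine (P (\bigcup_n F n)).
  by apply: fine_cvg; rewrite fineK ?fin_num_measure.
apply: cvg_trans hf; apply: near_eq_cvg; apply: nearW => n.
by rewrite /series/= sum_fine// => i _; rewrite fin_num_measure.
Qed.

(** * The tempered space-fractional Skellam process *)

Section skellam.
Context d (T : measurableType d) (R : realType) (P : probability T R).

(** The event that the difference of the counts is [k] splits into the events
    that they are [n + i] and [n + j], where [i] and [j] are the positive and the
    negative part of [k]; this treats both signs of [k] at once. The signs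
    [(-1) ^+ (n + i)] and [(-1) ^+ (n + j)] of the two weights leave
    [(-1) ^+ (i + j)]. *)
Lemma cvg_skellam_pmf (lambda1 lambda2 alpha1 alpha2 mu1 mu2 : R)
    (N1 N2 : R -> T -> nat) (D1 D2 : R -> T -> R)
    (hlambda1 : 0 < lambda1) (hlambda2 : 0 < lambda2)
    (halpha1 : 0 < alpha1 < 1) (halpha2 : 0 < alpha2 < 1)
    (hmu1 : 0 < mu1) (hmu2 : 0 < mu2)
    (hN1 : poisson_process P lambda1 N1) (hN2 : poisson_process P lambda2 N2)
    (hD1 : tempered_stable_subordinator P alpha1 mu1 D1)
    (hD2 : tempered_stable_subordinator P alpha2 mu2 D2)
    (hind : independent_processes4 P
              (real_process N1) (real_process N2) D1 D2)
    (t : R) (ht : 0 <= t) (i j : nat) (k : int) (a1 a2 : nat -> R) :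
  k = i%:Z - j%:Z -> (i == 0%N) || (j == 0%N) ->
  (forall n, a1 (n + i)%N = (1 + mu1 / lambda1) ^- (n + i) *
    fw alpha1 (n + i) (- ((lambda1 + mu1) `^ alpha1) * t)) ->
  (forall n, a2 (n + j)%N = (1 + mu2 / lambda2) ^- (n + j) *
    fw alpha2 (n + j) (- ((lambda2 + mu2) `^ alpha2) * t)) ->
  series (fun n : nat =>
      (-1) ^+ (i + j) / ((n + i)`!%:R * (n + j)`!%:R)
      * expR (t * (mu1 `^ alpha1 + mu2 `^ alpha2))
      * a1 (n + i)%N * a2 (n + j)%N)
    @ \oo --> skellam_pmf P N1 N2 D1 D2 k t.
Proof.
move=> kij ij0 a1E a2E.
pose F n := [set w | N1 (D1 t w) w = (n + i)%N /\ N2 (D2 t w) w = (n + j)%N].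
have law n := joint_count_law hlambda1 hlambda2 hN1 hN2 hD1 hD2 hind ht (n + i) (n + j).
have mF n : measurable (F n) by have [] := law n.
have tF : trivIset setT F.
  move=> n m _ _ [w [[n1 _] [m1 _]]]; move: m1; rewrite n1 => /eqP.
  by rewrite eqn_add2r => /eqP.
have UF : \bigcup_n F n = [set w | tempered_skellam N1 N2 D1 D2 t w = k].
  apply/seteqP; split=> w; rewrite /tempered_skellam /=.
    by move=> [n _ [-> ->]]; rewrite kij !PoszD; ring.
  set x := N1 _ _; set y := N2 _ _ => xy.
  have {}xy : (x + j = y + i)%N.
    apply/eqP; rewrite -eqz_nat !PoszD; apply/eqP; lia.
  exists (x - i)%N => //; rewrite /F /= -/x -/y; lia.
rewrite /skellam_pmf -UF.
apply: cvg_trans (cvg_series_measure_bigcup (P := P) mF tF).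
apply: near_eq_cvg; apply: nearW => M; apply: eq_bigr => n _.
have [_ ->] := law n; rewrite /poisson_weight.
rewrite (tempered_poisson_weight (subordinator_measurable hD1 ht)
  (fun w => subordinator_ge0 w hD1 ht) _ halpha1 hmu1 hlambda1
  (fun s s0 => tss_laplace hD1 s0 ht)).
rewrite (tempered_poisson_weight (subordinator_measurable hD2 ht)
  (fun w => subordinator_ge0 w hD2 ht) _ halpha2 hmu2 hlambda2
  (fun s s0 => tss_laplace hD2 s0 ht)).
rewrite -a1E -a2E mulrDr expRD.
have -> : (-1) ^+ (i + j) = (-1) ^+ (n + i) * (-1) ^+ (n + j) :> R.
  by rewrite -exprD addnACA [in RHS]exprD addnn -[_ ^+ n.*2]signr_odd odd_double mul1r.
by rewrite invfM; ring.
Qed.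

End skellam.

Theorem theorem7p3 (R : realType) (d : measure_display) (T : measurableType d)
    (P : probability T R)
    (lambda1 lambda2 alpha1 alpha2 mu1 mu2 : R)
    (N1 N2 : R -> T -> nat) (D1 D2 : R -> T -> R)
    (hlambda1 : 0 < lambda1) (hlambda2 : 0 < lambda2)
    (halpha1 : 0 < alpha1 < 1) (halpha2 : 0 < alpha2 < 1)
    (hmu1 : 0 < mu1) (hmu2 : 0 < mu2)
    (hN1 : poisson_process P lambda1 N1) (hN2 : poisson_process P lambda2 N2)
    (hD1 : tempered_stable_subordinator P alpha1 mu1 D1)
    (hD2 : tempered_stable_subordinator P alpha2 mu2 D2)
    (hind : independent_processes4 P
              (real_process N1) (real_process N2) D1 D2)
    (t : R) (ht : 0 <= t) :
  let A1 (j : nat) := series (tsf_term alpha1 lambda1 mu1 t j) in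
  let A2 (j : nat) := series (tsf_term alpha2 lambda2 mu2 t j) in
  [/\ mu1 < lambda1 -> forall j : nat, cvgn (A1 j),
      mu2 < lambda2 -> forall j : nat, cvgn (A2 j) &
      forall k : int,
        (0 <= k ->
         (forall n : nat, cvgn (A1 (n + `|k|)%N)) ->
         (forall n : nat, cvgn (A2 n)) ->
         series (fun n : nat =>
             (-1) ^+ `|k|%N / (n`!%:R * ((n + `|k|)`!)%:R)
             * expR (t * (mu1 `^ alpha1 + mu2 `^ alpha2))
             * limn (A1 (n + `|k|)%N) * limn (A2 n))
           @ \oo --> skellam_pmf P N1 N2 D1 D2 k t) /\
        (k < 0 ->
         (forall n : nat, cvgn (A1 n)) ->
         (forall n : nat, cvgn (A2 (n + `|k|)%N)) ->
         series (fun n : nat =>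
             (-1) ^+ `|k|%N / (n`!%:R * ((n + `|k|)`!)%:R)
             * expR (t * (mu1 `^ alpha1 + mu2 `^ alpha2))
             * limn (A1 n) * limn (A2 (n + `|k|)%N))
           @ \oo --> skellam_pmf P N1 N2 D1 D2 k t)].
Proof.
move=> A1 A2; split.
- by move=> ml j; apply/cvg_ex; eexists; exact: cvg_tsf.
- by move=> ml j; apply/cvg_ex; eexists; exact: cvg_tsf.
move=> k; split=> [k0 c1 c2|k0 c1 c2].
- have kE : k = `|k|%N%:Z - 0%N%:Z by rewrite subr0 gez0_abs.
  have := cvg_skellam_pmf hlambda1 hlambda2 halpha1 halpha2 hmu1 hmu2 hN1 hN2
    hD1 hD2 hind ht (i := `|k|%N) (j := 0%N) (k := k)
    (a1 := fun n => limn (A1 n)) (a2 := fun n => limn (A2 n)) kE (orbT _).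
  move=> h; apply: cvg_trans (h _ _).
  + apply: near_eq_cvg; apply: nearW => M; apply: eq_bigr => n _.
    by rewrite !addn0 [(n + _)`!%:R * _]mulrC.
  + move=> n; exact: (lim_tsf _ hlambda1 halpha1 hmu1 ht c1).
  + move=> n; apply: (lim_tsf (k := 0%N) _ hlambda2 halpha2 hmu2 ht) => m.
    by rewrite addn0; exact: c2.
- have kE : k = 0%N%:Z - `|k|%N%:Z by rewrite sub0r ltz0_abs// opprK.
  have := cvg_skellam_pmf hlambda1 hlambda2 halpha1 halpha2 hmu1 hmu2 hN1 hN2
    hD1 hD2 hind ht (i := 0%N) (j := `|k|%N) (k := k)
    (a1 := fun n => limn (A1 n)) (a2 := fun n => limn (A2 n)) kE isT.
  move=> h; apply: cvg_trans (h _ _).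
  + apply: near_eq_cvg; apply: nearW => M; apply: eq_bigr => n _.
    by rewrite !addn0.
  + move=> n; apply: (lim_tsf (k := 0%N) _ hlambda1 halpha1 hmu1 ht) => m.
    by rewrite addn0; exact: c1.
  + move=> n; exact: (lim_tsf _ hlambda2 halpha2 hmu2 ht c2).
Qed.
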